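(* Let $k$ be a perfect field of characteristic $p>0$, $V=W(k)$, $A=W(k)\llbracket x_2,\dots,x_d\rrbracket$, $x_1:=p$, and let $I=(\mathbf x_1,\dots,\mathbf x_n)\subseteq A$ where $\mathbf x_i=x_1^{\epsilon_{i1}}x_2^{\epsilon_{i2}}\cdots x_d^{\epsilon_{id}}$ with all $\epsilon_{ij}\in\{0,1\}$. Put $R=A/I$. Let $\phi:A\to A$ be the Frobenius lift given by the $\delta$-structure with $\delta(x_j)=0$ for $2\le j\le d$, let $R_i$ be the $i$-fold colimit of $R$ along the induced map $\phi_R$ (see context), and let $V_i=V[p^{1/p^i}]$. Then the tower $$R=R_{\mathrm{red}}=(R_0)_{\mathrm{red}}\to(R_1\otimes_VV_1)_{\mathrm{red}}\to(R_2\otimes_VV_2)_{\mathrm{red}}\to\cdots$$ is a perfectoid tower arising from $(R,(p))$.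
   Context: All rings are commutative; $p$ is a fixed prime. $\phi$ restricts to the Witt-vector Frobenius on $W(k)$ and $\phi(x_j)=x_j^p$ for $j\ge2$; one has $\phi(I)\subseteq I$, so $\phi$ induces $\phi_R:R\to R$. $R_i:=\operatorname{colim}\{R\xrightarrow{\phi_R}\cdots\xrightarrow{\phi_R}R\}$ ($i$ arrows), with transition map $R_i\to R_{i+1}$ induced by the identity on the first $i+1$ copies of $R$; $R_i$ is a $V$-algebra via $V\to R=R_0\to R_i$. $V_0=V\to V_1\to V_2\to\cdots$ are the inclusions for a fixed compatible system of $p$-power roots of $p$. The tower in the claim is induced by $R_i\otimes_VV_i\to R_{i+1}\otimes_VV_{i+1}$. $(-)_{\mathrm{red}}$ is the quotient by the nilradical. A tower of rings is a direct system $R_0\xrightarrow{t_0}R_1\xrightarrow{t_1}\cdots$. Purely inseparable tower arising from $(R,I_0)$ ($I_0\subseteq R$ an ideal): (a) $R_0=R$ and $p\in I_0$; (b) each induced map $\overline{t_i}:R_i/I_0R_i\to R_{i+1}/I_0R_{i+1}$ is injective; (c) the image of Frobenius on $R_{i+1}/I_0R_{i+1}$ is contained in the image of $\overline{t_i}$. Then there is a unique ring map $F_i:R_{i+1}/I_0R_{i+1}\to R_i/I_0R_i$ (the $i$-th Frobenius projection) with $\overline{t_i}\circ F_i$ equal to Frobenius. Perfectoid tower arising from $(R,I_0)$: a purely inseparable tower arising from $(R,I_0)$ with moreover: (d) each $F_i$ is surjective; (e) $I_0R_i$ lies in the Jacobson radical of $R_i$; (f) $I_0$ is principal, and $R_1$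 contains a principal ideal $I_1$ with $I_1^p=I_0R_1$ and $\ker(F_i)=I_1(R_{i+1}/I_0R_{i+1})$ for all $i$; (g) with $(R_i)_{I_0\text{-tor}}$ the elements annihilated by some power of $I_0$, one has $I_0(R_i)_{I_0\text{-tor}}=0$ and there is a (unique) bijection $(F_i)_{\mathrm{tor}}:(R_{i+1})_{I_0\text{-tor}}\to(R_i)_{I_0\text{-tor}}$ compatible with $F_i$ via the natural maps $(R_j)_{I_0\text{-tor}}\to R_j/I_0R_j$. *)

(* Defs.v *)
From HB Require Import structures.
From mathcomp Require Import all_boot all_order all_algebra.
From mathcomp Require Import boolp ring.
From mathcomp Require finmap monalg mpoly.

Set Implicit Arguments.
Unset Strict Implicit.
Unset Printing Implicit Defensive.

Import GRing.Theory.
Local Open Scope ring_scope.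
Local Open Scope quotient_scope.

Record ideal (A : comPzRingType) := Ideal {
  in_ideal :> A -> Prop;
  ideal0 : in_ideal 0;
  idealD : forall x y, in_ideal x -> in_ideal y -> in_ideal (x + y);
  idealM : forall a x, in_ideal x -> in_ideal (a * x) }.

Section IdealTheory.
Variable A : comPzRingType.
Implicit Types I J : ideal A.

Lemma idealN I x : I x -> I (- x).
Proof. by rewrite -mulN1r; apply: idealM. Qed.

Lemma idealB I x y : I x -> I y -> I (x - y).
Proof. by move=> Ix /idealN; apply: idealD. Qed.

Lemma ideal_sum I (T : Type) (s : seq T) (F : T -> A) :
  (forall t, I (F t)) -> I (\sum_(t <- s) F t).
Proof.
move=> IF; elim/big_ind: _ => //; first exact: ideal0.
by move=> x y; apply: idealD.
Qed.

Definition eq_ideal I J := forall x, I x <-> J x.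

Definition gen_ideal (S : A -> Prop) : ideal A.
Proof.
exists (fun x => forall J, (forall s, S s -> J s) -> J x).
- by move=> J _; apply: ideal0.
- by move=> x y Sx Sy J SJ; apply: idealD; [apply: Sx | apply: Sy].
- by move=> a x Sx J SJ; apply: idealM; apply: Sx.
Defined.

Lemma gen_idealP S s : S s -> gen_ideal S s.
Proof. by move=> Ss J; apply. Qed.

Definition principal a : ideal A := gen_ideal (fun x => x = a).

Definition ideal_mul I J : ideal A :=
  gen_ideal (fun x => exists a b, [/\ I a, J b & x = a * b]).

Definition unit_ideal : ideal A := gen_ideal (fun=> True).

Fixpoint ideal_exp I n : ideal A :=
  if n is n'.+1 then ideal_mul I (ideal_exp I n') else unit_ideal.

Definition maximal_ideal I :=
  ~ I 1 /\ forall J, (forall x, I x -> J x) -> ~ J 1 -> eq_ideal I J.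

Definition in_jacobson x := forall I, maximal_ideal I -> I x.

Definition nilradical : ideal A.
Proof.
exists (fun x => exists n, x ^+ n = 0).
- by exists 1%N; rewrite expr1.
- move=> x y [m xm] [n yn]; exists (m + n)%N.
  rewrite exprDn big1 // => -[i /= lei] _.
  have [lemi|ltmi] := leqP n i.
    by rewrite -(subnK lemi) exprD yn !mulr0 mul0rn.
  have lem : (m <= m + n - i)%N by rewrite -addnBA ?leq_addr // ltnW.
  by rewrite -(subnK lem) exprD xm mulr0 mul0r mul0rn.
- by move=> a x [n xn]; exists n; rewrite exprMn xn mulr0.
Defined.

End IdealTheory.

Definition ext_ideal (A B : comPzRingType) (f : A -> B) (I : ideal A) : ideal B :=
  gen_ideal (fun y => exists2 x, I x & y = f x).

Lemma ext_ideal_map (A B C : comPzRingType) (I : ideal A) (f : A -> B)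
    (h : A -> C) (g : {rmorphism B -> C}) :
  (forall a, g (f a) = h a) -> forall x, ext_ideal f I x -> ext_ideal h I (g x).
Proof.
move=> gf x; pose K := fun x => ext_ideal h I (g x).
have K0 : K 0 by rewrite /K rmorph0; apply: ideal0.
have KD y z : K y -> K z -> K (y + z) by rewrite /K rmorphD; apply: idealD.
have KM a y : K y -> K (a * y) by rewrite /K rmorphM; apply: idealM.
move/(_ (Ideal K0 KD KM)); apply => y [a Ia ->] /=.
by rewrite /K gf; apply: gen_idealP; exists a.
Qed.

Lemma nilradical_map (A B : comPzRingType) (f : {rmorphism A -> B}) x :
  nilradical A x -> nilradical B (f x).
Proof. by case=> n xn; exists n; rewrite -rmorphXn xn rmorph0. Qed.

Section Quotient.
Variables (A : comPzRingType) (I : ideal A).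

Definition quot_eq (x y : A) := `[< I (x - y) >].

Lemma quot_eqP : equiv_class_of quot_eq.
Proof.
split=> [x|x y|y x z].
- by apply/asboolP; rewrite subrr; apply: ideal0.
- by apply/asboolP/asboolP => /idealN; rewrite opprB.
- move=> /asboolP xy /asboolP yz; apply/asboolP.
  by rewrite -(subrKA y); apply: idealD.
Qed.

Canonical quot_equiv := EquivRelPack quot_eqP.
Definition quot := {eq_quot quot_eq}.
HB.instance Definition _ : EqQuotient A quot_eq quot := EqQuotient.on quot.
HB.instance Definition _ := Choice.on quot.

Definition quot_pi (x : A) : quot := \pi x.
Definition quot_repr (u : quot) : A := repr u.

Lemma quot_reprK : cancel quot_repr quot_pi.
Proof. exact: reprK. Qed.

Lemma quot_pi_eq x y : quot_pi x = quot_pi y <-> I (x - y).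
Proof.
by split=> [/eqmodP /asboolP|?]; last apply/eqmodP/asboolP.
Qed.

Lemma quot_piW (P : quot -> Prop) : (forall x, P (quot_pi x)) -> forall u, P u.
Proof. exact: quotW. Qed.

Let qzero : quot := quot_pi 0.
Let qone : quot := quot_pi 1.
Let qopp (x : quot) : quot := quot_pi (- quot_repr x).
Let qadd (x y : quot) : quot := quot_pi (quot_repr x + quot_repr y).
Let qmul (x y : quot) : quot := quot_pi (quot_repr x * quot_repr y).

Let reprP x : I (quot_repr (quot_pi x) - x).
Proof. by apply/quot_pi_eq; rewrite quot_reprK. Qed.

Let pi_opp x : qopp (quot_pi x) = quot_pi (- x).
Proof. by apply/quot_pi_eq; rewrite -opprD; apply/idealN/reprP. Qed.

Let pi_add x y : qadd (quot_pi x) (quot_pi y) = quot_pi (x + y).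
Proof.
apply/quot_pi_eq; rewrite opprD addrACA; apply: idealD; exact: reprP.
Qed.

Let pi_mul x y : qmul (quot_pi x) (quot_pi y) = quot_pi (x * y).
Proof.
apply/quot_pi_eq; set x' := quot_repr _; set y' := quot_repr _.
have -> : x' * y' - x * y = y' * (x' - x) + x * (y' - y).
  by rewrite !mulrBr addrA (mulrC y' x') (mulrC y' x) subrK.
by apply: idealD; apply: idealM; apply: reprP.
Qed.

Let qaddA : associative qadd.
Proof. by do 3![elim/quot_piW=> ?]; rewrite !pi_add addrA. Qed.
Let qaddC : commutative qadd.
Proof. by do 2![elim/quot_piW=> ?]; rewrite !pi_add addrC. Qed.
Let qadd0 : left_id qzero qadd.
Proof. by elim/quot_piW=> ?; rewrite pi_add add0r. Qed.
Let qaddN : left_inverse qzero qopp qadd.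
Proof. by elim/quot_piW=> ?; rewrite pi_opp pi_add addNr. Qed.
HB.instance Definition _ := GRing.isZmodule.Build quot qaddA qaddC qadd0 qaddN.

Let qmulA : associative qmul.
Proof. by do 3![elim/quot_piW=> ?]; rewrite !pi_mul mulrA. Qed.
Let qmulC : commutative qmul.
Proof. by do 2![elim/quot_piW=> ?]; rewrite !pi_mul mulrC. Qed.
Let qmul1 : left_id qone qmul.
Proof. by elim/quot_piW=> ?; rewrite pi_mul mul1r. Qed.
Let qmulD : left_distributive qmul +%R.
Proof.
have qD u v : u + v = qadd u v by [].
by do 3![elim/quot_piW=> ?]; rewrite !qD !(pi_add, pi_mul) mulrDl.
Qed.
HB.instance Definition _ :=
  GRing.Zmodule_isComPzRing.Build quot qmulA qmulC qmul1 qmulD.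

Lemma quot_pi_zmod : zmod_morphism quot_pi.
Proof. by move=> x y; rewrite -pi_add -pi_opp. Qed.
Lemma quot_pi_monoid : monoid_morphism quot_pi.
Proof. by split=> // x y; rewrite -pi_mul. Qed.
HB.instance Definition _ :=
  GRing.isZmodMorphism.Build A quot quot_pi quot_pi_zmod.
HB.instance Definition _ :=
  GRing.isMonoidMorphism.Build A quot quot_pi quot_pi_monoid.

End Quotient.

Arguments quot_pi {A} I x.

Section QuotientMap.
Variables (A B : comPzRingType) (f : {rmorphism A -> B}).
Variables (I : ideal A) (J : ideal B) (fIJ : forall x, I x -> J (f x)).

Definition quot_map_fun & (forall x, I x -> J (f x)) :=
  fun u : quot I => quot_pi J (f (quot_repr u)).

Lemma quot_map_funE x : quot_map_fun fIJ (quot_pi I x) = quot_pi J (f x).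
Proof.
apply/quot_pi_eq; rewrite -rmorphB; apply: fIJ.
by apply/quot_pi_eq; rewrite quot_reprK.
Qed.

Lemma quot_map_zmod : zmod_morphism (quot_map_fun fIJ).
Proof.
elim/quot_piW=> x; elim/quot_piW=> y.
by rewrite -rmorphB !quot_map_funE !rmorphB.
Qed.
Lemma quot_map_monoid : monoid_morphism (quot_map_fun fIJ).
Proof.
split=> [|]; first by rewrite -(rmorph1 (quot_pi I)) quot_map_funE !rmorph1.
elim/quot_piW=> x; elim/quot_piW=> y.
by rewrite -rmorphM !quot_map_funE !rmorphM.
Qed.
HB.instance Definition _ :=
  GRing.isZmodMorphism.Build _ _ (quot_map_fun fIJ) quot_map_zmod.
HB.instance Definition _ :=
  GRing.isMonoidMorphism.Build _ _ (quot_map_fun fIJ) quot_map_monoid.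

Definition quot_map : {rmorphism quot I -> quot J} := quot_map_fun fIJ.

Lemma quot_mapE x : quot_map (quot_pi I x) = quot_pi J (f x).
Proof. exact: quot_map_funE. Qed.

End QuotientMap.

(* B ⊗_V C for V-algebras f : V -> B and g : V -> C: formal sums of pairs,   *)
(* the sequence [:: (b_1, c_1); ...; (b_n, c_n)] standing for the sum of the *)
(* b_i ⊗ c_i, identified when every V-balanced biadditive map to an abelian  *)
(* group takes the same value on them.                                       *)
Record balanced (V B C : comPzRingType) (f : V -> B) (g : V -> C)
    (M : zmodType) (beta : B -> C -> M) : Prop := Balanced {
  balancedDl : forall b b' c, beta (b + b') c = beta b c + beta b' c;
  balancedDr : forall b c c', beta b (c + c') = beta b c + beta b c';
  balancedV : forall v b c, beta (f v * b) c = beta b (g v * c) }.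

Section Tensor.
Variables (V B C : comPzRingType) (f : {rmorphism V -> B}) (g : {rmorphism V -> C}).

Definition formal_sum (M : zmodType) (beta : B -> C -> M) (s : seq (B * C)) : M :=
  \sum_(z <- s) beta z.1 z.2.

Definition tensor_eq (s t : seq (B * C)) :=
  `[< forall (M : zmodType) (beta : B -> C -> M), balanced f g beta ->
        formal_sum beta s = formal_sum beta t >].

Lemma tensor_eqP : equiv_class_of tensor_eq.
Proof.
split=> [s|s t|s t u]; first exact/asboolP.
  by apply/asboolP/asboolP => st M beta bal; rewrite st.
by move=> /asboolP st /asboolP tu; apply/asboolP => M beta bal; rewrite st // tu.
Qed.

Canonical tensor_equiv := EquivRelPack tensor_eqP.
Definition tensor := {eq_quot tensor_eq}.
HB.instance Definition _ : EqQuotient (seq (B * C)) tensor_eq tensor :=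
  EqQuotient.on tensor.
HB.instance Definition _ := Choice.on tensor.

Definition tensor_pi (s : seq (B * C)) : tensor := \pi s.
Definition tensor_repr (u : tensor) : seq (B * C) := repr u.

Lemma tensor_reprK : cancel tensor_repr tensor_pi.
Proof. exact: reprK. Qed.

Lemma tensor_pi_eq s t : tensor_pi s = tensor_pi t <->
  (forall (M : zmodType) (beta : B -> C -> M), balanced f g beta ->
     formal_sum beta s = formal_sum beta t).
Proof. by split=> [/eqmodP /asboolP|?]; last apply/eqmodP/asboolP. Qed.

Lemma tensor_piW (P : tensor -> Prop) : (forall s, P (tensor_pi s)) -> forall u, P u.
Proof. exact: quotW. Qed.

Definition fs_opp (s : seq (B * C)) := [seq (- z.1, z.2) | z <- s].
Definition fs_mul (s t : seq (B * C)) :=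
  [seq (y.1 * z.1, y.2 * z.2) | y <- s, z <- t].

Section Sums.
Variables (M : zmodType) (beta : B -> C -> M) (bal : balanced f g beta).

Lemma balanced0l c : beta 0 c = 0.
Proof. by apply: (@addrI _ (beta 0 c)); rewrite -(balancedDl bal) !addr0. Qed.

Lemma balancedNl b c : beta (- b) c = - beta b c.
Proof.
by apply/eqP; rewrite -addr_eq0 -(balancedDl bal) addNr balanced0l.
Qed.

Lemma formal_sum_cat s t :
  formal_sum beta (s ++ t) = formal_sum beta s + formal_sum beta t.
Proof. exact: big_cat. Qed.

Lemma formal_sum_opp s : formal_sum beta (fs_opp s) = - formal_sum beta s.
Proof.
rewrite /formal_sum big_map -sumrN.
by apply: eq_bigr => z _; rewrite balancedNl.
Qed.

Definition mul_left (s : seq (B * C)) b c := formal_sum (fun b' c' => beta (b' * b) (c' * c)) s.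
Definition mul_right (t : seq (B * C)) b c := formal_sum (fun b' c' => beta (b * b') (c * c')) t.

Lemma formal_sum_mull s t : formal_sum beta (fs_mul s t) = formal_sum (mul_left s) t.
Proof. by rewrite /formal_sum big_allpairs_dep /= exchange_big. Qed.

Lemma formal_sum_mulr s t : formal_sum beta (fs_mul s t) = formal_sum (mul_right t) s.
Proof. by rewrite /formal_sum big_allpairs_dep. Qed.

Lemma balanced_left s : balanced f g (mul_left s).
Proof.
split=> [b b' c|b c c'|v b c].
- by rewrite -big_split; apply: eq_bigr => z _; rewrite mulrDr (balancedDl bal).
- by rewrite -big_split; apply: eq_bigr => z _; rewrite mulrDr (balancedDr bal).
- by apply: eq_bigr => z _; rewrite mulrCA (balancedV bal) mulrCA.
Qed.

Lemma mul_leftC s b c : mul_left s b c = mul_right s b c.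
Proof. by apply: eq_bigr => z _; rewrite !(mulrC z.1, mulrC z.2). Qed.

Lemma balanced_right s : balanced f g (mul_right s).
Proof.
by have [] := balanced_left s => D1 D2 D3; split=> *; rewrite -!mul_leftC.
Qed.

End Sums.

Let tzero : tensor := tensor_pi [::].
Let tone : tensor := tensor_pi [:: (1, 1)].
Let topp (x : tensor) : tensor := tensor_pi (fs_opp (tensor_repr x)).
Let tadd (x y : tensor) : tensor := tensor_pi (tensor_repr x ++ tensor_repr y).
Let tmul (x y : tensor) : tensor := tensor_pi (fs_mul (tensor_repr x) (tensor_repr y)).

Let reprP s (M : zmodType) (beta : B -> C -> M) : balanced f g beta ->
  formal_sum beta (tensor_repr (tensor_pi s)) = formal_sum beta s.
Proof. exact: (tensor_pi_eq _ _).1 (tensor_reprK _) M beta. Qed.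

Let pi_opp s : topp (tensor_pi s) = tensor_pi (fs_opp s).
Proof. by apply/tensor_pi_eq => M beta bal; rewrite !(formal_sum_opp bal) reprP. Qed.

Let pi_add s t : tadd (tensor_pi s) (tensor_pi t) = tensor_pi (s ++ t).
Proof. by apply/tensor_pi_eq => M beta bal; rewrite !formal_sum_cat !reprP. Qed.

Let pi_mul s t : tmul (tensor_pi s) (tensor_pi t) = tensor_pi (fs_mul s t).
Proof.
apply/tensor_pi_eq => M beta bal.
rewrite formal_sum_mull (reprP _ (balanced_left bal _)) -formal_sum_mull.
by rewrite formal_sum_mulr (reprP _ (balanced_right bal _)) -formal_sum_mulr.
Qed.

Let taddA : associative tadd.
Proof. by do 3![elim/tensor_piW=> ?]; rewrite !pi_add catA. Qed.
Let taddC : commutative tadd.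
Proof.
do 2![elim/tensor_piW=> ?]; rewrite !pi_add.
by apply/tensor_pi_eq => M beta bal; rewrite !formal_sum_cat addrC.
Qed.
Let tadd0 : left_id tzero tadd.
Proof. by elim/tensor_piW=> ?; rewrite pi_add. Qed.
Let taddN : left_inverse tzero topp tadd.
Proof.
elim/tensor_piW=> s; rewrite pi_opp pi_add.
apply/tensor_pi_eq => M beta bal.
by rewrite formal_sum_cat (formal_sum_opp bal) addNr /formal_sum big_nil.
Qed.
HB.instance Definition _ := GRing.isZmodule.Build tensor taddA taddC tadd0 taddN.

Let tmulC : commutative tmul.
Proof.
elim/tensor_piW=> s; elim/tensor_piW=> t; rewrite !pi_mul.
apply/tensor_pi_eq => M beta bal.
by rewrite formal_sum_mull formal_sum_mulr; apply: eq_bigr => z _; rewrite mul_leftC.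
Qed.
Let tmulA : associative tmul.
Proof.
elim/tensor_piW=> s; elim/tensor_piW=> t; elim/tensor_piW=> u; rewrite !pi_mul.
apply/tensor_pi_eq => M beta bal.
rewrite formal_sum_mulr [RHS]formal_sum_mull; rewrite /formal_sum.
rewrite /mul_right /mul_left /formal_sum.
under eq_bigr => y _ do rewrite big_allpairs_dep /= exchange_big.
rewrite exchange_big; apply: eq_bigr => z _; rewrite big_allpairs_dep /=.
by apply: eq_bigr => x _; apply: eq_bigr => y _; rewrite !mulrA.
Qed.
Let tmul1 : left_id tone tmul.
Proof.
elim/tensor_piW=> s; rewrite pi_mul; apply/tensor_pi_eq => M beta bal.
rewrite formal_sum_mull; apply: eq_bigr => z _.
by rewrite /mul_left /formal_sum big_seq1 !mul1r.
Qed.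
Let tmulD : left_distributive tmul +%R.
Proof.
have tD u v : u + v = tadd u v by [].
elim/tensor_piW=> s; elim/tensor_piW=> t; elim/tensor_piW=> u.
rewrite !tD !(pi_add, pi_mul); apply/tensor_pi_eq => M beta bal.
by rewrite formal_sum_cat !formal_sum_mulr formal_sum_cat.
Qed.
HB.instance Definition _ :=
  GRing.Zmodule_isComPzRing.Build tensor tmulA tmulC tmul1 tmulD.

Definition pure (b : B) (c : C) : tensor := tensor_pi [:: (b, c)].

Let formal_sum1 (M : zmodType) (beta : B -> C -> M) b c :
  formal_sum beta [:: (b, c)] = beta b c.
Proof. exact: big_seq1. Qed.

Lemma pure_balanced : balanced f g pure.
Proof.
have tD u v : u + v = tadd u v by [].
split=> [b b' c|b c c'|v b c]; rewrite ?tD ?pi_add;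
  apply/tensor_pi_eq => M beta bal; rewrite ?(formal_sum_cat _ [:: _] [:: _]) !formal_sum1.
- exact: balancedDl bal _ _ _.
- exact: balancedDr bal _ _ _.
- exact: balancedV bal _ _ _.
Qed.

Lemma pureM b c b' c' : pure b c * pure b' c' = pure (b * b') (c * c').
Proof. exact: pi_mul. Qed.

Lemma pure1 : 1 = pure 1 1.
Proof. by []. Qed.

Lemma tensor_piE s : tensor_pi s = \sum_(z <- s) pure z.1 z.2.
Proof.
have tD u v : u + v = tadd u v by [].
elim: s => [|[b c] s IH]; first by rewrite big_nil.
by rewrite big_cons -IH tD pi_add.
Qed.

Definition tensor_inl (b : B) : tensor := pure b 1.
Definition tensor_inr (c : C) : tensor := pure 1 c.

Lemma tensor_inl_zmod : zmod_morphism tensor_inl.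
Proof.
move=> b b'; rewrite /tensor_inl (balancedDl pure_balanced).
by rewrite (balancedNl pure_balanced).
Qed.
Lemma tensor_inl_monoid : monoid_morphism tensor_inl.
Proof. by split=> // b b'; rewrite /tensor_inl pureM mulr1. Qed.
HB.instance Definition _ :=
  GRing.isZmodMorphism.Build B tensor tensor_inl tensor_inl_zmod.
HB.instance Definition _ :=
  GRing.isMonoidMorphism.Build B tensor tensor_inl tensor_inl_monoid.

Let pure0r b : pure b 0 = 0.
Proof. by apply: (@addrI _ (pure b 0)); rewrite -(balancedDr pure_balanced) !addr0. Qed.
Let pureNr b c : pure b (- c) = - pure b c.
Proof.
by apply/eqP; rewrite -addr_eq0 -(balancedDr pure_balanced) addNr pure0r.
Qed.

Lemma tensor_inr_zmod : zmod_morphism tensor_inr.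
Proof. by move=> c c'; rewrite /tensor_inr (balancedDr pure_balanced) pureNr. Qed.
Lemma tensor_inr_monoid : monoid_morphism tensor_inr.
Proof. by split=> // c c'; rewrite /tensor_inr pureM mulr1. Qed.
HB.instance Definition _ :=
  GRing.isZmodMorphism.Build C tensor tensor_inr tensor_inr_zmod.
HB.instance Definition _ :=
  GRing.isMonoidMorphism.Build C tensor tensor_inr tensor_inr_monoid.

End Tensor.

Section TensorLift.
Variables (V B C : comPzRingType) (f : {rmorphism V -> B}) (g : {rmorphism V -> C}).

Lemma tensor_lift (M : zmodType) (beta : B -> C -> M) : balanced f g beta ->
  exists h : tensor f g -> M, zmod_morphism h /\ forall b c, h (pure f g b c) = beta b c.
Proof.
move=> bal; exists (fun u => formal_sum beta (tensor_repr u)).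
have hE s : formal_sum beta (tensor_repr (tensor_pi f g s)) = formal_sum beta s.
  exact: (tensor_pi_eq _ _ _ _).1 (tensor_reprK _) M beta bal.
split=> [|b c]; last by rewrite hE /formal_sum big_seq1.
elim/tensor_piW=> s; elim/tensor_piW=> t.
have -> : tensor_pi f g s - tensor_pi f g t = tensor_pi f g (s ++ fs_opp t).
  rewrite !tensor_piE big_cat big_map -sumrN; congr (_ + _).
  by apply: eq_bigr => z _; rewrite (balancedNl (pure_balanced f g)).
by rewrite !hE formal_sum_cat (formal_sum_opp bal).
Qed.

End TensorLift.

Section TensorMap.
Variables (V B C : comPzRingType) (f : {rmorphism V -> B}) (g : {rmorphism V -> C}).
Variables (B' C' : comPzRingType).
Variables (f' : {rmorphism V -> B'}) (g' : {rmorphism V -> C'}).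
Variables (h : {rmorphism B -> B'}) (k : {rmorphism C -> C'}).
Hypotheses (hf : forall v, h (f v) = f' v) (kg : forall v, k (g v) = g' v).

Definition tensor_map_fun & (forall v, h (f v) = f' v) & (forall v, k (g v) = g' v) :=
  fun u : tensor f g => tensor_pi f' g' [seq (h z.1, k z.2) | z <- tensor_repr u].

Lemma tensor_map_fun_pi s : tensor_map_fun hf kg (tensor_pi f g s) =
  tensor_pi f' g' [seq (h z.1, k z.2) | z <- s].
Proof.
apply/tensor_pi_eq => M beta bal; rewrite /formal_sum !big_map.
have bal' : balanced f g (fun b c => beta (h b) (k c)).
  split=> [b b' c|b c c'|v b c]; rewrite ?rmorphD ?rmorphM.
  - exact: balancedDl bal _ _ _.
  - exact: balancedDr bal _ _ _.
  - by rewrite hf kg (balancedV bal).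
exact: (tensor_pi_eq _ _ _ _).1 (tensor_reprK _) M _ bal'.
Qed.

Lemma tensor_map_fun_pure b c :
  tensor_map_fun hf kg (pure f g b c) = pure f' g' (h b) (k c).
Proof. by rewrite tensor_map_fun_pi. Qed.

Lemma tensor_map_zmod : zmod_morphism (tensor_map_fun hf kg).
Proof.
elim/tensor_piW=> s; elim/tensor_piW=> t.
have -> : tensor_pi f g s - tensor_pi f g t = tensor_pi f g (s ++ fs_opp t).
  rewrite !tensor_piE big_cat big_map -sumrN; congr (_ + _).
  by apply: eq_bigr => z _; rewrite (balancedNl (pure_balanced f g)).
rewrite !tensor_map_fun_pi !tensor_piE !big_map big_cat /= big_map -sumrN.
congr (_ + _); apply: eq_bigr => z _.
by rewrite rmorphN (balancedNl (pure_balanced f' g')).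
Qed.

Lemma tensor_map_monoid : monoid_morphism (tensor_map_fun hf kg).
Proof.
split=> [|]; first by rewrite pure1 tensor_map_fun_pure !rmorph1.
elim/tensor_piW=> s; elim/tensor_piW=> t.
have -> : tensor_pi f g s * tensor_pi f g t = tensor_pi f g (fs_mul s t).
  rewrite !tensor_piE big_allpairs_dep mulr_suml; apply: eq_bigr => y _.
  by rewrite mulr_sumr; apply: eq_bigr => z _; rewrite pureM.
rewrite !tensor_map_fun_pi !tensor_piE !big_map big_allpairs_dep mulr_suml.
apply: eq_bigr => y _; rewrite mulr_sumr; apply: eq_bigr => z _.
by rewrite pureM !rmorphM.
Qed.
HB.instance Definition _ := GRing.isZmodMorphism.Build _ _
  (tensor_map_fun hf kg) tensor_map_zmod.
HB.instance Definition _ := GRing.isMonoidMorphism.Build _ _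
  (tensor_map_fun hf kg) tensor_map_monoid.

Definition tensor_map : {rmorphism tensor f g -> tensor f' g'} :=
  tensor_map_fun hf kg.

Lemma tensor_mapE b c : tensor_map (pure f g b c) = pure f' g' (h b) (k c).
Proof. exact: tensor_map_fun_pure. Qed.

End TensorMap.

Module WittPoly.
Import finmap monalg.

(* Integer polynomials in variables X_(a, n), where X_(a, n) stands for the  *)
(* n-th component of the a-th Witt vector.                                   *)
Definition wpoly := {malg int[{cmonom (nat * nat)%type}]}.
HB.instance Definition _ := GRing.ComNzRing.on wpoly.

Definition wvar (a n : nat) : wpoly := << ucm (a, n) >>.

Definition monom_eval (B : comNzRingType) (e : nat -> nat -> B)
    (m : {cmonom (nat * nat)%type}) : B :=
  \prod_(i <- finsupp m) e i.1 i.2 ^+ m i.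

Lemma monom_evalEw (B : comNzRingType) (e : nat -> nat -> B)
    (m : {cmonom (nat * nat)%type}) (d : {fset nat * nat}) :
  (finsupp m `<=` d)%fset -> monom_eval e m = \prod_(i <- d) e i.1 i.2 ^+ m i.
Proof.
move=> le; apply: big_fset_incl => // i _.
by rewrite -cmE_eq0 => /eqP ->; rewrite expr0.
Qed.

Lemma monom_eval_mmorphism (B : comNzRingType) (e : nat -> nat -> B) :
  mmorphism (monom_eval e).
Proof.
split=> [m1 m2|]; last by rewrite /monom_eval mdom1 big_seq_fset0.
rewrite (@monom_evalEw _ e m1 (finsupp m1 `|` finsupp m2)%fset) ?fsubsetUl //.
rewrite (@monom_evalEw _ e m2 (finsupp m1 `|` finsupp m2)%fset) ?fsubsetUr //.
rewrite (@monom_evalEw _ e (mmul m1 m2) (finsupp m1 `|` finsupp m2)%fset) ?mdomD //.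
by rewrite -big_split; apply: eq_bigr => i _; rewrite cmM exprD.
Qed.
HB.instance Definition _ (B : comNzRingType) (e : nat -> nat -> B) :=
  isMultiplicative.Build _ B (monom_eval e) (monom_eval_mmorphism e).

Definition weval (B : comNzRingType) (e : nat -> nat -> B) (f : wpoly) : B :=
  mmap intr (monom_eval e) f.

HB.instance Definition _ (B : comNzRingType) (e : nat -> nat -> B) :=
  GRing.isZmodMorphism.Build wpoly B (weval e) (@mmap_is_additive _ _ _ _ _).
Lemma weval_monoid (B : comNzRingType) (e : nat -> nat -> B) :
  monoid_morphism (weval e).
Proof.
have [M1 M2] := @mmap_is_multiplicative {cmonom (nat * nat)%type} int B intr (monom_eval e).
by split.
Qed.
HB.instance Definition _ (B : comNzRingType) (e : nat -> nat -> B) :=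
  GRing.isMonoidMorphism.Build wpoly B (weval e) (weval_monoid e).

Lemma weval_var (B : comNzRingType) (e : nat -> nat -> B) a n : weval e (wvar a n) = e a n.
Proof.
by rewrite /weval mmapU mul1r /monom_eval mdomU big_seq_fset1 cmUU expr1.
Qed.

Lemma weval_morph (B B' : comNzRingType) (r : {rmorphism B -> B'}) (e : nat -> nat -> B) f :
  r (weval e f) = weval (fun a n => r (e a n)) f.
Proof.
rewrite /weval /mmap rmorph_sum; apply: eq_bigr => m _.
rewrite rmorphM rmorph_int /monom_eval rmorph_prod; congr (_ * _).
by apply: eq_bigr => i _; rewrite rmorphXn.
Qed.

Lemma monom_ind (Q : {cmonom (nat * nat)%type} -> Prop) :
  Q mone -> (forall i m, Q m -> Q (mmul (ucm i) m)) -> forall m, Q m.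
Proof.
move=> Q1 QM m; have [d] := ubnP (mdeg m).
elim: d m => [|d IH] m; first by rewrite ltn0.
rewrite ltnS => lemd; have [->|m1] := eqVneq m mone; first exact: Q1.
have : finsupp m != fset0.
  by apply: contraNneq m1 => m0; apply/eqP/mdeg_eq0I; rewrite mdegE m0 big_seq_fset0.
case/fset0Pn => i mi; rewrite -cmE_neq0 -lt0n in mi.
have mE : m = mmul (ucm i) (divcm m (ucm i)).
  apply/eqP/cmP => j; rewrite cmM divcmE cmU.
  by case: eqP => [<-|_]; [rewrite subnKC | rewrite subn0].
rewrite mE; apply: QM; apply: IH; apply: leq_trans lemd.
by rewrite [in X in (_ < X)%N]mE mdegM mdegU.
Qed.

Lemma wpoly_ind (K : wpoly -> Prop) :
  K 1 -> (forall a n, K (wvar a n)) -> (forall f g, K f -> K g -> K (f - g)) ->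
  (forall f g, K f -> K g -> K (f * g)) -> forall f, K f.
Proof.
move=> K1 KX KB KM f.
have K0 : K 0 by rewrite -(subrr 1); apply: KB.
have KN g : K g -> K (- g) by move=> Kg; rewrite -sub0r; apply: KB.
have KD g h : K g -> K h -> K (g + h) by move=> Kg Kh; rewrite -[h]opprK; apply/KB/KN.
have Kn (n : nat) : K n%:R by elim: n => // n IH; rewrite mulrS; apply: KD.
have Kz (c : int) : K c%:~R.
  by case: c => n; [exact: (Kn n) | rewrite NegzE mulrNz; exact/KN/(Kn n.+1)].
have Km (m : {cmonom (nat * nat)%type}) : K (<< m >> : wpoly).
  elim/monom_ind: m => [|[a n] m Km]; first exact: K1.
  have -> : << mmul (ucm (a, n)) m >> = wvar a n * << m >> :> wpoly.
    by rewrite /wvar malgM_def fgmulUU mul1r.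
  by apply: KM; [exact: KX | exact: Km].
rewrite [f]monalgE; elim/big_ind: _ => [||m _]; [exact: K0 | exact: KD |].
have -> : << f@_m *g m >> = (f@_m)%:~R * << m >> :> wpoly.
  by rewrite -{1}(intz f@_m) (raddfMz (mkmalgU m)) mulrzl.
by apply: KM; [exact: Kz | exact: Km].
Qed.

Definition wpoly_quo (f : wpoly) (c : nat) : wpoly :=
  [malg m in msupp f => (f@_m %/ c)%Z].

Lemma wpoly_quoK c f : (0 < c)%N -> wpoly_quo (c%:R * f) c = f.
Proof.
move=> c0; apply/malgP => m; rewrite /wpoly_quo mcoeffE.
have E : (c%:R * f)@_m = f@_m * c%:Z :> int.
  by rewrite mulr_natl mcoeffMn -mulr_natr natz.
rewrite E mulzK -?lt0n //; case: ifPn => //; rewrite -mcoeff_eq0 E.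
by rewrite mulf_eq0 eqz_nat (gtn_eqF c0) orbF => /eqP.
Qed.

Section Ghost.
Variable p : nat.

Definition ghost (B : comNzRingType) (n : nat) (x : nat -> B) : B :=
  \sum_(i < n.+1) (p ^ i)%:R * x i ^+ (p ^ (n - i)).

Lemma ghost_morph (B B' : comNzRingType) (r : {rmorphism B -> B'}) n (x : nat -> B) :
  r (ghost n x) = ghost n (fun i => r (x i)).
Proof.
rewrite rmorph_sum; apply: eq_bigr => i _.
by rewrite rmorphM rmorph_nat rmorphXn.
Qed.

Lemma ghost_recr (B : comNzRingType) n (x : nat -> B) :
  ghost n x = \sum_(i < n) (p ^ i)%:R * x i ^+ (p ^ (n - i)) + (p ^ n)%:R * x n.
Proof. by rewrite /ghost big_ord_recr /= subnn expn0 expr1. Qed.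

Lemma eq_ghost (B : comNzRingType) n (x y : nat -> B) :
  (forall i, (i <= n)%N -> x i = y i) -> ghost n x = ghost n y.
Proof. by move=> xy; apply: eq_bigr => i _; rewrite xy // -ltnS. Qed.

Hypothesis p_pr : prime p.

Definition pcong (B : comNzRingType) n (f g : B) := exists q, f - g = (p ^ n)%:R * q.

Section PowerCongruence.
Variables (B : comNzRingType) (n : nat).
Implicit Types f g h : B.

Lemma pcong_refl f : pcong n f f.
Proof. by exists 0; rewrite subrr mulr0. Qed.

Lemma pcong_sym f g : pcong n f g -> pcong n g f.
Proof. by case=> q fg; exists (- q); rewrite mulrN -fg opprB. Qed.

Lemma pcong_trans g f h : pcong n f g -> pcong n g h -> pcong n f h.
Proof.
by case=> q fg [r gh]; exists (q + r); rewrite mulrDr -fg -gh addrA subrK.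
Qed.

Lemma pcongB f g f' g' : pcong n f g -> pcong n f' g' -> pcong n (f - f') (g - g').
Proof.
case=> q fg [r fg']; exists (q - r); rewrite mulrBr -fg -fg'; ring.
Qed.

Lemma pcongD f g f' g' : pcong n f g -> pcong n f' g' -> pcong n (f + f') (g + g').
Proof.
by case=> q fg [r fg']; exists (q + r); rewrite mulrDr -fg -fg' opprD addrACA.
Qed.

Lemma pcongM f g f' g' : pcong n f g -> pcong n f' g' -> pcong n (f * f') (g * g').
Proof.
case=> q fg [r fg']; exists (q * f' + g * r).
by rewrite mulrDr mulrA -fg mulrCA -fg'; ring.
Qed.

Lemma pcong_sum m (F G : 'I_m -> B) :
  (forall i, pcong n (F i) (G i)) -> pcong n (\sum_i F i) (\sum_i G i).
Proof.
move=> FG; elim/big_rec2: _ => [|i y x _]; first exact: pcong_refl.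
exact: pcongD.
Qed.

End PowerCongruence.

Lemma pcongX (B : comNzRingType) n (f g : B) :
  pcong n.+1 f g -> pcong n.+2 (f ^+ p) (g ^+ p).
Proof.
case=> q fg; have [p' pE] : exists p', p = p'.+1.
  by exists p.-1; rewrite prednK // prime_gt0.
have [r fgr] : pcong n.+1 (\sum_(i < p) f ^+ (p.-1 - i) * g ^+ i) (p%:R * g ^+ p.-1).
  have -> : p%:R * g ^+ p.-1 = \sum_(i < p) g ^+ (p.-1 - i) * g ^+ i.
    rewrite (eq_bigr (fun=> g ^+ p.-1)) => [|i _].
      by rewrite sumr_const card_ord mulr_natl.
    by rewrite -exprD subnK // -ltnS prednK ?prime_gt0.
  apply: pcong_sum => i; apply: pcongM; last exact: pcong_refl.
  elim: (p.-1 - i)%N => [|m IH]; first exact: pcong_refl.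
  by rewrite !exprS; apply: pcongM => //; exists q.
exists (q * (g ^+ p.-1 + (p ^ n)%:R * r)).
have -> : f ^+ p - g ^+ p = (f - g) * (\sum_(i < p) f ^+ (p.-1 - i) * g ^+ i).
  by rewrite pE subrXX.
have -> : \sum_(i < p) f ^+ (p.-1 - i) * g ^+ i =
    p%:R * (g ^+ p.-1 + (p ^ n)%:R * r).
  by rewrite mulrDr mulrA -natrM -expnS -fgr addrC subrK.
by rewrite fg (expnSr p n.+1) natrM -!mulrA; congr (_ * _); rewrite mulrCA.
Qed.

Lemma pcongXX (B : comNzRingType) n k (f g : B) :
  pcong n.+1 f g -> pcong (n + k).+1 (f ^+ (p ^ k)) (g ^+ (p ^ k)).
Proof.
move=> fg; elim: k => [|k IH]; first by rewrite addn0 expn0 !expr1.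
by rewrite addnS expnSr !exprM; apply: pcongX.
Qed.

Lemma pcong_frobD (B : comNzRingType) (f g : B) :
  pcong 1 ((f + g) ^+ p) (f ^+ p + g ^+ p).
Proof.
have [p' pE] : exists p', p = p'.+1.
  by exists p.-1; rewrite prednK // prime_gt0.
exists (\sum_(i < p') (f ^+ (p - i.+1) * g ^+ i.+1) *+ ('C(p, i.+1) %/ p)).
rewrite exprDn pE big_ord_recl big_ord_recr /= -pE.
rewrite subn0 expr0 mulr1 bin0 mulr1n /bump /= !add1n -pE subnn expr0 mul1r binn mulr1n.
have E (a b c : B) : a + (b + c) - (a + c) = b by ring.
rewrite E.
rewrite expn1 mulr_sumr; apply: eq_bigr => i _.
rewrite /bump /= add1n mulr_natl -mulrnA; congr (_ *+ _).
by rewrite divnK //; apply: prime_dvd_bin => //=; rewrite pE ltnS; exact: ltn_ord.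
Qed.

Section GhostInverse.
Variables (P : comNzRingType) (quo : P -> nat -> P).

(* The sequence s with ghost n s = u n for all n, solving the equations one  *)
(* after the other; [ghost_unghost] shows that the divisions are exact.      *)
Fixpoint unghost_upto (u : nat -> P) (n : nat) : seq P :=
  if n is m.+1 then
    let s := unghost_upto u m in
    rcons s (quo
      (u m - \sum_(i < m) (p ^ i)%:R * s`_i ^+ (p ^ (m - i))) (p ^ m))
  else [::].

Definition unghost (u : nat -> P) (n : nat) : P := (unghost_upto u n.+1)`_n.

Hypothesis quoK : forall c f, (0 < c)%N -> quo (c%:R * f) c = f.
Variable phi : {rmorphism P -> P}.
Hypothesis phiP : forall f, pcong 1 (phi f) (f ^+ p).

Lemma torsion_free c (f : P) : (0 < c)%N -> c%:R * f = 0 -> f = 0.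
Proof.
move=> c0 cf; have {}cf : c%:R * f = c%:R * 0 by rewrite cf mulr0.
by rewrite -(quoK f c0) cf quoK.
Qed.

Lemma ghost_inj (x y : nat -> P) :
  (forall n, ghost n x = ghost n y) -> forall n, x n = y n.
Proof.
move=> xy n; have [m] := ubnP n; elim: m n => // m IH n; rewrite ltnS => lenm.
apply/eqP; rewrite -subr_eq0; apply/eqP.
apply: (@torsion_free (p ^ n)); first by rewrite expn_gt0 prime_gt0.
have := xy n; rewrite !ghost_recr (eq_bigr (fun i : 'I_n => (p ^ i)%:R * y i ^+ (p ^ (n - i)))).
  by move/addrI => E; rewrite mulrBr E subrr.
by move=> i _; rewrite IH // (leq_trans _ lenm).
Qed.

Lemma ghost_unghost (u : nat -> P) :
  (forall n, pcong n.+1 (phi (u n)) (u n.+1)) ->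
  forall n, ghost n (unghost u) = u n.
Proof.
move=> uP.
have sz n : size (unghost_upto u n) = n by elim: n => //= n IH; rewrite size_rcons IH.
have nthE n i : (i < n)%N -> (unghost_upto u n)`_i = unghost u i.
  elim: n => // n IH; rewrite ltnS leq_eqVlt => /orP[/eqP -> //|lt].
  by rewrite /= nth_rcons sz lt IH.
have step n : pcong n (u n) (\sum_(i < n) (p ^ i)%:R * unghost u i ^+ (p ^ (n - i))) ->
    ghost n (unghost u) = u n.
  case=> q E; rewrite ghost_recr.
  have -> : unghost u n = q.
    rewrite /unghost /= nth_rcons sz ltnn eqxx.
    under eq_bigr => i _ do rewrite nthE //.
    by rewrite E quoK // expn_gt0 prime_gt0.
  by rewrite -E addrC subrK.
elim=> [|n IH]; apply: step.
  by exists (u 0%N); rewrite big_ord0 subr0 expn0 mul1r.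
apply: pcong_trans (pcong_sym (uP n)) _; rewrite -IH ghost_morph.
apply: pcong_sum => i.
have [q E] : pcong (n.+1 - i) (phi (unghost u i) ^+ (p ^ (n - i)))
    (unghost u i ^+ (p ^ (n.+1 - i))).
  by rewrite subSn ?leq_ord // expnS exprM; apply: (pcongXX (n - i) (phiP _)).
exists q.
by rewrite -mulrBr E mulrA -natrM -expnD subnKC // ltnW // ltnS leq_ord.
Qed.

End GhostInverse.

Definition wfrob_lift : {rmorphism wpoly -> wpoly} :=
  weval (fun a n => wvar a n ^+ p).

Lemma wfrob_liftP f : pcong 1 (wfrob_lift f) (f ^+ p).
Proof.
elim/wpoly_ind: f => [|a n|f g|f g].
- by rewrite rmorph1 expr1n; apply: pcong_refl.
- by rewrite /wfrob_lift /= weval_var; apply: pcong_refl.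
- move=> Kf Kg; rewrite rmorphB; apply: pcong_trans (pcongB Kf Kg) _.
  have := pcong_frobD (f - g) g; rewrite subrK => fg.
  by have := pcongB fg (pcong_refl 1 (g ^+ p)); rewrite addrK.
- move=> Kf Kg; rewrite (rmorphM (wfrob_lift)) exprMn; exact: (pcongM Kf Kg).
Qed.

Lemma ghost_var_cong a n :
  pcong n.+1 (wfrob_lift (ghost n (wvar a))) (ghost n.+1 (wvar a)).
Proof.
rewrite [ghost n.+1 _]ghost_recr ghost_morph; exists (- wvar a n.+1).
rewrite opprD addrA -[_ - \sum_(_ < _) _]sumrB big1 ?add0r ?mulrN // => i _.
by rewrite /wfrob_lift /= weval_var -exprM -expnS -subSn ?leq_ord // subrr.
Qed.

End Ghost.
End WittPoly.

Section WittPolynomials.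
Import WittPoly.
Variables (p : nat) (p_pr : prime p).

(* The integer polynomials whose ghost components are the sum, opposite and  *)
(* product of the ghost components of the variables.                         *)
Definition add_wpoly : nat -> wpoly :=
  unghost p wpoly_quo (fun n => ghost p n (wvar 0) + ghost p n (wvar 1)).
Definition opp_wpoly : nat -> wpoly :=
  unghost p wpoly_quo (fun n => - ghost p n (wvar 0)).
Definition mul_wpoly : nat -> wpoly :=
  unghost p wpoly_quo (fun n => ghost p n (wvar 0) * ghost p n (wvar 1)).

Let solveP := ghost_unghost p_pr wpoly_quoK (wfrob_liftP p_pr).

Lemma ghost_add_wpoly n :
  ghost p n add_wpoly = ghost p n (wvar 0) + ghost p n (wvar 1).
Proof.
apply: solveP => m; rewrite (rmorphD (wfrob_lift p)).
exact: pcongD (ghost_var_cong p 0 m) (ghost_var_cong p 1 m).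
Qed.
Lemma ghost_opp_wpoly n : ghost p n opp_wpoly = - ghost p n (wvar 0).
Proof.
apply: solveP => m; rewrite (rmorphN (wfrob_lift p)) -[- _]sub0r.
rewrite -[X in pcong _ _ _ X]sub0r.
exact: pcongB (pcong_refl p m.+1 0) (ghost_var_cong p 0 m).
Qed.
Lemma ghost_mul_wpoly n :
  ghost p n mul_wpoly = ghost p n (wvar 0) * ghost p n (wvar 1).
Proof.
apply: solveP => m; rewrite (rmorphM (wfrob_lift p)).
exact: pcongM (ghost_var_cong p 0 m) (ghost_var_cong p 1 m).
Qed.

End WittPolynomials.

Record witt (p : nat) (p_pr : prime p) (k : Type) := Witt { wcoef : nat -> k }.

Section WittRing.
Import WittPoly.
Variables (p : nat) (p_pr : prime p).

HB.instance Definition _ (k : Type) := gen_eqMixin (witt p_pr k).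
HB.instance Definition _ (k : Type) := gen_choiceMixin (witt p_pr k).

Lemma wittP (k : Type) (x y : witt p_pr k) : (forall n, wcoef x n = wcoef y n) -> x = y.
Proof. by case: x y => [x] [y] /= xy; congr Witt; apply/funext. Qed.

Section Ops.
Variable k : comNzRingType.
Implicit Types x y z : witt p_pr k.

Definition wapply (s : nat -> wpoly) x y : witt p_pr k :=
  Witt p_pr (fun n => weval (fun a m => wcoef (if a == 0%N then x else y) m) (s n)).

Definition witt_zero : witt p_pr k := Witt p_pr (fun=> 0).
Definition witt_one : witt p_pr k := Witt p_pr (fun n => (n == 0%N)%:R).
Definition witt_add x y := wapply (add_wpoly p) x y.
Definition witt_opp x := wapply (opp_wpoly p) x witt_zero.
Definition witt_mul x y := wapply (mul_wpoly p) x y.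

Definition witt_ghost n x : k := ghost p n (wcoef x).

Lemma witt_ghost_apply s n x y : witt_ghost n (wapply s x y) =
  weval (fun a m => wcoef (if a == 0%N then x else y) m) (ghost p n s).
Proof. by rewrite /witt_ghost ghost_morph. Qed.

Lemma weval_ghost_var (e : nat -> nat -> k) n a :
  weval e (ghost p n (wvar a)) = ghost p n (e a).
Proof. by rewrite ghost_morph; apply: eq_ghost => i _; exact: weval_var. Qed.

Lemma witt_ghostD n x y :
  witt_ghost n (witt_add x y) = witt_ghost n x + witt_ghost n y.
Proof.
rewrite witt_ghost_apply (ghost_add_wpoly p_pr) (rmorphD (weval _)).
by congr (_ + _); exact: weval_ghost_var.
Qed.
Lemma witt_ghostN n x : witt_ghost n (witt_opp x) = - witt_ghost n x.
Proof.
rewrite witt_ghost_apply (ghost_opp_wpoly p_pr) (rmorphN (weval _)).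
by congr (- _); exact: weval_ghost_var.
Qed.
Lemma witt_ghostM n x y :
  witt_ghost n (witt_mul x y) = witt_ghost n x * witt_ghost n y.
Proof.
rewrite witt_ghost_apply (ghost_mul_wpoly p_pr) (rmorphM (weval _)).
by congr (_ * _); exact: weval_ghost_var.
Qed.
Lemma witt_ghost0 n : witt_ghost n witt_zero = 0.
Proof.
rewrite /witt_ghost /ghost big1 // => i _.
by rewrite expr0n gtn_eqF ?mulr0 // expn_gt0 prime_gt0.
Qed.
Lemma witt_ghost1 n : witt_ghost n witt_one = 1.
Proof.
rewrite /witt_ghost /ghost big_ord_recl big1 => [|i _] /=.
  by rewrite expn0 mul1r expr1n addr0.
by rewrite expr0n gtn_eqF ?mulr0 // expn_gt0 prime_gt0.
Qed.

End Ops.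

Definition witt_map_fun (k k' : comNzRingType) (r : k -> k') (x : witt p_pr k) :=
  Witt p_pr (fun n => r (wcoef x n)).

Section Transfer.
Variables (k k' : comNzRingType) (r : {rmorphism k -> k'}).
Implicit Types x y : witt p_pr k.
Local Notation wm := (witt_map_fun r).

Lemma witt_map_apply s x y : wm (wapply s x y) = wapply s (wm x) (wm y).
Proof.
apply: wittP => n /=; rewrite weval_morph; congr (weval _ _).
by apply/funext => a; apply/funext => m; case: eqP.
Qed.
Lemma witt_map0 : wm (witt_zero k) = witt_zero k'.
Proof. by apply: wittP => n; apply: rmorph0. Qed.
Lemma witt_map1 : wm (witt_one k) = witt_one k'.
Proof. by apply: wittP => n; apply: rmorph_nat. Qed.
Lemma witt_mapD x y : wm (witt_add x y) = witt_add (wm x) (wm y).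
Proof. exact: witt_map_apply. Qed.
Lemma witt_mapN x : wm (witt_opp x) = witt_opp (wm x).
Proof. by rewrite /witt_opp witt_map_apply witt_map0. Qed.
Lemma witt_mapM x y : wm (witt_mul x y) = witt_mul (wm x) (wm y).
Proof. exact: witt_map_apply. Qed.
End Transfer.

(* A polynomial identity holds for Witt vectors: it suffices to check it     *)
(* generically, over [wpoly], where the ghost maps are jointly injective.    *)
Inductive wterm :=
  TVar of nat | TZero | TOne | TOpp of wterm
| TAdd of wterm & wterm | TMul of wterm & wterm.

Fixpoint term_eval (B : comNzRingType) (e : nat -> B) (t : wterm) : B :=
  match t with
  | TVar i => e i
  | TZero => 0
  | TOne => 1
  | TOpp t => - term_eval e t
  | TAdd t u => term_eval e t + term_eval e u
  | TMul t u => term_eval e t * term_eval e u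
  end.

Fixpoint term_witt (k : comNzRingType) (e : nat -> witt p_pr k) (t : wterm) :
    witt p_pr k :=
  match t with
  | TVar i => e i
  | TZero => witt_zero k
  | TOne => witt_one k
  | TOpp t => witt_opp (term_witt e t)
  | TAdd t u => witt_add (term_witt e t) (term_witt e u)
  | TMul t u => witt_mul (term_witt e t) (term_witt e u)
  end.

Lemma witt_ghost_term (k : comNzRingType) (e : nat -> witt p_pr k) n t :
  witt_ghost n (term_witt e t) = term_eval (fun i => witt_ghost n (e i)) t.
Proof.
elim: t => [i|||t IH|t IHt u IHu|t IHt u IHu] //=.
- exact: witt_ghost0.
- exact: witt_ghost1.
- by rewrite witt_ghostN IH.
- by rewrite witt_ghostD IHt IHu.
- by rewrite witt_ghostM IHt IHu.
Qed.

Lemma witt_map_term (k k' : comNzRingType) (r : {rmorphism k -> k'})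
    (e : nat -> witt p_pr k) t :
  witt_map_fun r (term_witt e t) = term_witt (fun i => witt_map_fun r (e i)) t.
Proof.
elim: t => [i|||t IH|t IHt u IHu|t IHt u IHu] //=.
- exact: witt_map0.
- exact: witt_map1.
- by rewrite witt_mapN IH.
- by rewrite witt_mapD IHt IHu.
- by rewrite witt_mapM IHt IHu.
Qed.

Lemma witt_identity t u :
  (forall (B : comNzRingType) (e : nat -> B), term_eval e t = term_eval e u) ->
  forall (k : comNzRingType) (e : nat -> witt p_pr k), term_witt e t = term_witt e u.
Proof.
move=> tu k e; pose X a : witt p_pr wpoly := Witt p_pr (wvar a).
have eE : e = fun a => witt_map_fun (weval (fun a n => wcoef (e a) n)) (X a).
  by apply/funext => a; apply: wittP => n; exact/esym/weval_var.
have E : term_witt X t = term_witt X u.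
  apply: wittP; apply: (ghost_inj p_pr wpoly_quoK) => n.
  by rewrite -!/(witt_ghost n _) !witt_ghost_term tu.
by rewrite eE -!witt_map_term E.
Qed.

Section RingLaws.
Variable k : comNzRingType.
Implicit Types x y z : witt p_pr k.

Let env x y z := nth (witt_zero k) [:: x; y; z].
Local Notation v0 := (TVar 0).
Local Notation v1 := (TVar 1).
Local Notation v2 := (TVar 2).

Let waddA : associative (@witt_add k).
Proof.
move=> x y z; apply: (@witt_identity (TAdd v0 (TAdd v1 v2))
  (TAdd (TAdd v0 v1) v2) _ k (env x y z)) => B e; exact: addrA.
Qed.
Let waddC : commutative (@witt_add k).
Proof.
move=> x y; apply: (@witt_identity (TAdd v0 v1) (TAdd v1 v0) _ k (env x y x)).
by move=> B e; exact: addrC.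
Qed.
Let wadd0 : left_id (witt_zero k) (@witt_add k).
Proof.
move=> x; apply: (@witt_identity (TAdd TZero v0) v0 _ k (env x x x)).
by move=> B e; exact: add0r.
Qed.
Let waddN : left_inverse (witt_zero k) (@witt_opp k) (@witt_add k).
Proof.
move=> x; apply: (@witt_identity (TAdd (TOpp v0) v0) TZero _ k (env x x x)).
by move=> B e; exact: addNr.
Qed.
HB.instance Definition _ := GRing.isZmodule.Build (witt p_pr k) waddA waddC wadd0 waddN.

Let wmulA : associative (@witt_mul k).
Proof.
move=> x y z; apply: (@witt_identity (TMul v0 (TMul v1 v2))
  (TMul (TMul v0 v1) v2) _ k (env x y z)) => B e; exact: mulrA.
Qed.
Let wmulC : commutative (@witt_mul k).
Proof.
move=> x y; apply: (@witt_identity (TMul v0 v1) (TMul v1 v0) _ k (env x y x)).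
by move=> B e; exact: mulrC.
Qed.
Let wmul1 : left_id (witt_one k) (@witt_mul k).
Proof.
move=> x; apply: (@witt_identity (TMul TOne v0) v0 _ k (env x x x)).
by move=> B e; exact: mul1r.
Qed.
Let wmulD : left_distributive (@witt_mul k) (@witt_add k).
Proof.
move=> x y z; apply: (@witt_identity (TMul (TAdd v0 v1) v2)
  (TAdd (TMul v0 v2) (TMul v1 v2)) _ k (env x y z)) => B e; exact: mulrDl.
Qed.
Let wone0 : witt_one k != witt_zero k.
Proof.
by apply/eqP => /(congr1 (fun x => wcoef x 0)) /= /eqP; rewrite oner_eq0.
Qed.
HB.instance Definition _ :=
  GRing.Zmodule_isComNzRing.Build (witt p_pr k) wmulA wmulC wmul1 wmulD wone0.

End RingLaws.

End WittRing.

Section WittMap.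
Variables (p : nat) (p_pr : prime p) (k k' : comNzRingType) (r : {rmorphism k -> k'}).

Lemma witt_map_zmod : zmod_morphism (witt_map_fun (p_pr := p_pr) r).
Proof. by move=> x y; rewrite [LHS]witt_mapD witt_mapN. Qed.
Lemma witt_map_monoid : monoid_morphism (witt_map_fun (p_pr := p_pr) r).
Proof. by split; [apply: witt_map1 | apply: witt_mapM]. Qed.
HB.instance Definition _ :=
  GRing.isZmodMorphism.Build _ _ (witt_map_fun (p_pr := p_pr) r) witt_map_zmod.
HB.instance Definition _ :=
  GRing.isMonoidMorphism.Build _ _ (witt_map_fun (p_pr := p_pr) r) witt_map_monoid.
Definition witt_map : {rmorphism witt p_pr k -> witt p_pr k'} := witt_map_fun (p_pr := p_pr) r.
End WittMap.

Section GhostMorphism.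
Variables (p : nat) (p_pr : prime p) (k : comNzRingType) (n : nat).

Lemma witt_ghost_zmod : zmod_morphism (@witt_ghost p p_pr k n).
Proof. by move=> x y; rewrite [LHS]witt_ghostD witt_ghostN. Qed.
Lemma witt_ghost_monoid : monoid_morphism (@witt_ghost p p_pr k n).
Proof. by split; [apply: witt_ghost1 | apply: witt_ghostM]. Qed.
HB.instance Definition _ :=
  GRing.isZmodMorphism.Build _ _ (@witt_ghost p p_pr k n) witt_ghost_zmod.
HB.instance Definition _ :=
  GRing.isMonoidMorphism.Build _ _ (@witt_ghost p p_pr k n) witt_ghost_monoid.
End GhostMorphism.

(* In characteristic p the Witt vector Frobenius is the map induced by the   *)
(* Frobenius endomorphism of the coefficients.                               *)
Definition witt_frobenius (p : nat) (p_pr : prime p) (k : comNzRingType)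
    (pcharkp : p \in [pchar k]) : {rmorphism witt p_pr k -> witt p_pr k} :=
  witt_map p_pr (pFrobenius_aut pcharkp).

Section PowerSeries.
Import mpoly.

Record mpseries (m : nat) (B : Type) := MPSeries { mpscoef : 'X_{1..m} -> B }.

Section Ring.
Variables (m : nat) (B : comNzRingType).
Implicit Types f g h : mpseries m B.

Lemma mpseriesP f g : (forall u, mpscoef f u = mpscoef g u) -> f = g.
Proof. by case: f g => [f] [g] /= fg; congr MPSeries; apply/funext. Qed.

Definition mps_const (c : B) : mpseries m B := MPSeries (fun u => if u == 0%MM then c else 0).
Definition mps_var (i : 'I_m) : mpseries m B := MPSeries (fun u => (u == U_(i)%MM)%:R).
Definition mps_add f g := MPSeries (fun u => mpscoef f u + mpscoef g u).
Definition mps_opp f := MPSeries (fun u => - mpscoef f u).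
Definition mps_mul f g := MPSeries (fun u =>
  \sum_(k : 'X_{1..m < (mdeg u).+1, (mdeg u).+1} | u == (k.1 + k.2)%MM)
     mpscoef f k.1 * mpscoef g k.2).

Definition mps_trunc (N : nat) f : {mpoly B[m]} :=
  \sum_(k : 'X_{1..m < N}) mpscoef f k *: 'X_[k].

Lemma mps_truncE N f u : (mdeg u < N)%N -> (mps_trunc N f)@_u = mpscoef f u.
Proof.
move=> uN; rewrite raddf_sum (bigD1 (BMultinom uN)) //= mcoeffZ mcoeffX eqxx mulr1.
rewrite big1 ?addr0 // => k; rewrite mcoeffZ mcoeffX -val_eqE /= => /negPf ->.
by rewrite mulr0.
Qed.

Lemma mdeg_split (u v w : 'X_{1..m}) :
  u = (v + w)%MM -> (mdeg v <= mdeg u)%N /\ (mdeg w <= mdeg u)%N.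
Proof. by move=> ->; rewrite mdegD leq_addl leq_addr. Qed.

Lemma mps_mulE N f g u : (mdeg u < N)%N ->
  mpscoef (mps_mul f g) u = (mps_trunc N f * mps_trunc N g)@_u.
Proof.
move=> uN; rewrite (mcoeff_poly_mul _ _ (ltnSn (mdeg u))) /=.
apply: eq_bigr => k /eqP uk; have [l1 l2] := mdeg_split uk.
by rewrite !mps_truncE //; exact: leq_ltn_trans uN.
Qed.

Lemma mcoeff_mul_eq (p p' q q' : {mpoly B[m]}) u :
  (forall v, (mdeg v <= mdeg u)%N -> p@_v = p'@_v) ->
  (forall v, (mdeg v <= mdeg u)%N -> q@_v = q'@_v) -> (p * q)@_u = (p' * q')@_u.
Proof.
move=> pp qq; rewrite !(mcoeff_poly_mul _ _ (ltnSn (mdeg u))).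
apply: eq_bigr => k /eqP uk; have [l1 l2] := mdeg_split uk.
by rewrite pp ?qq.
Qed.

Lemma mps_trunc_mul N f g u : (mdeg u < N)%N ->
  (mps_trunc N (mps_mul f g))@_u = (mps_trunc N f * mps_trunc N g)@_u.
Proof. by move=> uN; rewrite mps_truncE // (@mps_mulE N _ _ u uN). Qed.

Lemma mps_addA : associative mps_add.
Proof. by move=> f g h; apply: mpseriesP => u /=; rewrite addrA. Qed.
Lemma mps_addC : commutative mps_add.
Proof. by move=> f g; apply: mpseriesP => u /=; rewrite addrC. Qed.
Lemma mps_add0 : left_id (mps_const 0) mps_add.
Proof. by move=> f; apply: mpseriesP => u /=; rewrite if_same add0r. Qed.
Lemma mps_addN : left_inverse (mps_const 0) mps_opp mps_add.
Proof. by move=> f; apply: mpseriesP => u /=; rewrite if_same addNr. Qed.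

Lemma mps_mulC : commutative mps_mul.
Proof.
by move=> f g; apply: mpseriesP => u; rewrite !(@mps_mulE (mdeg u).+1 _ _ u (ltnSn _)) mulrC.
Qed.
Lemma mps_mulA : associative mps_mul.
Proof.
move=> f g h; apply: mpseriesP => u; rewrite !(@mps_mulE (mdeg u).+1 _ _ u (ltnSn _)).
set N := (mdeg u).+1; pose t := mps_trunc N.
transitivity ((t f * (t g * t h))@_u).
  by apply: mcoeff_mul_eq => v lev //; rewrite mps_trunc_mul.
rewrite mulrA; apply: mcoeff_mul_eq => v lev //; by rewrite mps_trunc_mul.
Qed.
Lemma mps_mul1 : left_id (mps_const 1) mps_mul.
Proof.
move=> f; apply: mpseriesP => u; rewrite (@mps_mulE (mdeg u).+1 _ _ u (ltnSn _)).
rewrite -[RHS](@mps_truncE (mdeg u).+1 _ u (ltnSn _)) -[in RHS](mul1r (mps_trunc _ f)).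
apply: mcoeff_mul_eq => v lev //.
by rewrite mps_truncE //= mcoeff1; case: eqP.
Qed.
Lemma mps_mulD : left_distributive mps_mul mps_add.
Proof.
move=> f g h; apply: mpseriesP => u /=; rewrite -big_split.
by apply: eq_bigr => k _; rewrite mulrDl.
Qed.

End Ring.
End PowerSeries.

HB.instance Definition _ m (B : Type) := gen_eqMixin (mpseries m B).
HB.instance Definition _ m (B : Type) := gen_choiceMixin (mpseries m B).

Lemma mps_oner_neq0 (m : nat) (B : comNzRingType) : mps_const m (1 : B) != mps_const m 0.
Proof.
apply/eqP => /(congr1 (fun f => mpscoef f mpoly.mnm0)) /= /eqP.
by rewrite eqxx oner_eq0.
Qed.

HB.instance Definition _ m (B : comNzRingType) := GRing.isZmodule.Build (mpseries m B)
  (@mps_addA m B) (@mps_addC m B) (@mps_add0 m B) (@mps_addN m B).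
HB.instance Definition _ m (B : comNzRingType) := GRing.Zmodule_isComNzRing.Build (mpseries m B)
  (@mps_mulA m B) (@mps_mulC m B) (@mps_mul1 m B) (@mps_mulD m B) (@mps_oner_neq0 m B).

Section PowerSeriesTheory.
Import mpoly.
Variables (m : nat) (B : comNzRingType).
Implicit Types f g : mpseries m B.

Lemma mpscoefD f g u : mpscoef (f + g) u = mpscoef f u + mpscoef g u.
Proof. by []. Qed.
Lemma mpscoefN f u : mpscoef (- f) u = - mpscoef f u.
Proof. by []. Qed.
Lemma mpscoefM f g u : mpscoef (f * g) u =
  \sum_(k : 'X_{1..m < (mdeg u).+1, (mdeg u).+1} | u == (k.1 + k.2)%MM)
     mpscoef f k.1 * mpscoef g k.2.
Proof. by []. Qed.

Lemma mps_const_zmod : zmod_morphism (@mps_const m B).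
Proof.
by move=> c d; apply: mpseriesP => u; rewrite mpscoefD mpscoefN /=; case: eqP; rewrite ?subrr.
Qed.
Lemma mps_const_monoid : monoid_morphism (@mps_const m B).
Proof.
split=> // c d; apply: mpseriesP => u; rewrite [RHS](@mps_mulE m B (mdeg u).+1 _ _ u (ltnSn _)).
have E (e : B) v : (mdeg v <= mdeg u)%N -> (mps_trunc (mdeg u).+1 (mps_const m e))@_v = (e%:MP)@_v.
  by move=> lev; rewrite mps_truncE // mcoeffC /=; case: eqP; rewrite ?mulr1 ?mulr0.
rewrite (mcoeff_mul_eq (E c) (E d)) -mpolyCM mcoeffC /=.
by case: eqP; rewrite ?mulr1 ?mulr0.
Qed.
End PowerSeriesTheory.

Arguments mps_const {m B} c.
Arguments mps_var {m B} i.

HB.instance Definition _ (m : nat) (B : comNzRingType) :=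
  GRing.isZmodMorphism.Build B (mpseries m B) mps_const (@mps_const_zmod m B).
HB.instance Definition _ (m : nat) (B : comNzRingType) :=
  GRing.isMonoidMorphism.Build B (mpseries m B) mps_const (@mps_const_monoid m B).

(* 'C(p, i) %/ p is an exact division when p is prime and 0 < i < p.         *)
Record delta_structure (p : nat) (A : comPzRingType) := DeltaStructure {
  delta :> A -> A;
  delta0 : delta 0 = 0;
  delta1 : delta 1 = 0;
  deltaD : forall a b, delta (a + b) = delta a + delta b
    - \sum_(1 <= i < p) (a ^+ i * b ^+ (p - i)) *+ ('C(p, i) %/ p);
  deltaM : forall a b, delta (a * b) =
    a ^+ p * delta b + b ^+ p * delta a + p%:R * (delta a * delta b) }.

Section DeltaFrobenius.
Variables (p : nat) (p_pr : prime p) (A : comPzRingType) (d : delta_structure p A).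

Definition delta_frobenius_fun & prime p := fun a : A => a ^+ p + p%:R * d a.
Local Notation phi := (delta_frobenius_fun p_pr).

Lemma delta_frobeniusD a b : phi (a + b) = phi a + phi b.
Proof.
have p0 := prime_gt0 p_pr.
rewrite /delta_frobenius_fun deltaD mulrBr mulr_sumr.
have -> : \sum_(1 <= i < p) p%:R * ((a ^+ i * b ^+ (p - i)) *+ ('C(p, i) %/ p)) =
    \sum_(1 <= i < p) (a ^+ i * b ^+ (p - i)) *+ 'C(p, i).
  apply: eq_big_nat => i /andP[i0 ip].
  by rewrite mulr_natl -mulrnA divnK // prime_dvd_bin // i0.
rewrite [a + b]addrC exprDn -(big_mkord xpredT (fun i => (b ^+ (p - i) * a ^+ i) *+ 'C(p, i))).
rewrite big_nat_recr //= big_ltn // subn0 expr0 mulr1 bin0 mulr1n.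
rewrite subnn expr0 mul1r binn mulr1n.
under eq_bigr => i _ do rewrite mulrC.
set S := \sum_(_ <= _ < _) _; rewrite mulrDr.
by ring.
Qed.

Lemma delta_frobenius_zmod : zmod_morphism phi.
Proof. by move=> a b; apply: (addIr (phi b)); rewrite -delta_frobeniusD !subrK. Qed.

Lemma delta_frobenius_monoid : monoid_morphism phi.
Proof.
split=> [|a b]; rewrite /delta_frobenius_fun; first by rewrite delta1 mulr0 addr0 expr1n.
by rewrite deltaM exprMn; ring.
Qed.
HB.instance Definition _ := GRing.isZmodMorphism.Build A A phi delta_frobenius_zmod.
HB.instance Definition _ := GRing.isMonoidMorphism.Build A A phi delta_frobenius_monoid.

Definition delta_frobenius : {rmorphism A -> A} := phi.

Lemma delta_frobeniusE a : delta_frobenius a = a ^+ p + p%:R * d a.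
Proof. by []. Qed.

End DeltaFrobenius.

Section Monomials.
Variables (p : nat) (p_pr : prime p) (k : comNzRingType) (m : nat).
Local Notation A := (mpseries m (witt p_pr k)).

(* The regular parameters: index 0 is p, the other indices are the variables *)
(* of the power series ring.                                                 *)
Definition parameter (j : 'I_m.+1) : A :=
  if unlift ord0 j is Some i then mps_var i else p%:R.

Definition squarefree_monomial (eps : 'I_m.+1 -> bool) : A :=
  \prod_(j < m.+1) parameter j ^+ eps j.

Definition monomial_ideal (n : nat) (eps : 'I_n -> 'I_m.+1 -> bool) : ideal A :=
  gen_ideal (fun a => exists i : 'I_n, a = squarefree_monomial (eps i)).

Variable d : delta_structure p A.
Hypothesis d_var : forall i, d (mps_var i) = 0.
Local Notation phi := (delta_frobenius p_pr d).

Lemma delta_frobenius_parameter j : exists c, phi (parameter j) = c * parameter j.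
Proof.
rewrite /parameter; case: unlift => [i|]; last by exists 1; rewrite rmorph_nat mul1r.
exists (mps_var i ^+ p.-1).
by rewrite delta_frobeniusE d_var mulr0 addr0 -exprSr prednK // prime_gt0.
Qed.

Lemma monomial_ideal_stable n (eps : 'I_n -> 'I_m.+1 -> bool) x :
  monomial_ideal eps x -> monomial_ideal eps (phi x).
Proof.
pose J := monomial_ideal eps; pose K y := J (phi y).
have K0 : K 0 by rewrite /K rmorph0; apply: ideal0.
have KD y z : K y -> K z -> K (y + z) by rewrite /K rmorphD; apply: idealD.
have KM a y : K y -> K (a * y) by rewrite /K rmorphM; apply: idealM.
move/(_ (Ideal K0 KD KM)); apply => _ [i ->] /=; rewrite /K /squarefree_monomial.
have [c ->] : exists c, phi (squarefree_monomial (eps i)) = c * squarefree_monomial (eps i).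
  rewrite /squarefree_monomial; elim/big_rec: _ => [|j y _ [c Ec]].
    by exists 1; rewrite rmorph1 mulr1.
  have [e Ee] := delta_frobenius_parameter j.
  exists (e ^+ eps i j * c); rewrite rmorphM Ec rmorphXn Ee exprMn.
  by rewrite -!mulrA; congr (_ * _); rewrite mulrCA.
by apply: idealM; apply: gen_idealP; exists i.
Qed.

End Monomials.

Section ChainColimit.
Variables (R : comPzRingType) (f : {rmorphism R -> R}).

Fixpoint iter_rmorph (n : nat) : {rmorphism R -> R} :=
  if n is n'.+1 then f \o iter_rmorph n' else idfun.

Lemma iter_rmorphSr n x : iter_rmorph n.+1 x = iter_rmorph n (f x).
Proof. by elim: n => //= n ->. Qed.

(* The colimit of R -> R -> ... -> R (i arrows, each of them f) is the last  *)
(* copy of R, since the index category has a terminal object.                *)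
Definition chain_colim (f : {rmorphism R -> R}) (i : nat) : comPzRingType := R.

Definition chain_leg (i : nat) (j : 'I_i.+1) : {rmorphism R -> chain_colim f i} :=
  iter_rmorph (i - j).

Definition chain_next (i : nat) : {rmorphism chain_colim f i -> chain_colim f i.+1} := f.

Lemma chain_leg_cocone i (j l : 'I_i.+1) x :
  l = j.+1 :> nat -> chain_leg l (f x) = chain_leg j x.
Proof.
move=> lj; rewrite /chain_leg -iter_rmorphSr lj.
by rewrite -subSn ?subSS // -lj -ltnS ltn_ord.
Qed.

Lemma chain_colim_universal i (S : comPzRingType) (c : 'I_i.+1 -> {rmorphism R -> S}) :
  (forall (j l : 'I_i.+1) x, l = j.+1 :> nat -> c l (f x) = c j x) ->
  exists2 h : {rmorphism chain_colim f i -> S},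
    forall j x, h (chain_leg j x) = c j x &
    forall h' : chain_colim f i -> S,
      (forall j x, h' (chain_leg j x) = c j x) -> h' =1 h.
Proof.
move=> cP; exists (c ord_max) => [j x|h' h'P x]; last first.
  by rewrite -(h'P ord_max) /chain_leg /= subnn.
rewrite /chain_leg; have [n nE] := ubnP (i - j)%N; elim: n => // n IH in j x nE *.
have [ij|ji] := leqP i j.
  have jE : j = ord_max by apply/val_inj/eqP; rewrite eqn_leq -ltnS ltn_ord.
  by rewrite jE /= subnn.
have lt : (j.+1 < i.+1)%N by [].
rewrite -(cP j (Ordinal lt)) // -IH /=; last by rewrite -ltnS -subSn // subSS.
by rewrite -iter_rmorphSr -subSn // subSS.
Qed.

Lemma chain_nextE i (j : 'I_i.+1) x :
  chain_next i (chain_leg j x) = chain_leg (widen_ord (leqnSn i.+1) j) x.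
Proof. by rewrite /chain_leg /chain_next /= subSn // -ltnS. Qed.

End ChainColimit.

(* A compatible system of p-power roots of p: (proot i) ^ (p ^ i) = p.       *)
Record p_power_roots (p : nat) (K : fieldType) := PPowerRoots {
  proot :> nat -> K;
  proot0 : proot 0%N = p%:R;
  prootS : forall i, proot i.+1 ^+ p = proot i }.

Section Adjoin.
Variables (V : comNzRingType) (K : fieldType) (iota : {rmorphism V -> K}).

(* V[z], for z in a field K containing V.                                    *)
Definition adjoin (z : K) : {pred K} :=
  fun x => `[< exists f : {poly V}, x = (map_poly iota f).[z] >].

Lemma adjoin_subring z : subring_closed (adjoin z).
Proof.
split=> [|x y|x y].
- by apply/asboolP; exists 1; rewrite rmorph1 hornerC.
- move=> /asboolP[f ->] /asboolP[g ->]; apply/asboolP; exists (f - g).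
  by rewrite rmorphB hornerD hornerN.
- move=> /asboolP[f ->] /asboolP[g ->]; apply/asboolP; exists (f * g).
  by rewrite rmorphM hornerM.
Qed.
HB.instance Definition _ z := GRing.isSubringClosed.Build K (adjoin z) (adjoin_subring z).

Record adjoin_ring (z : K) := AdjoinRing {
  adjoin_val : K;
  adjoin_valP : adjoin_val \in adjoin z }.

Section Structure.
Variable z : K.
HB.instance Definition _ := [isSub for @adjoin_val z].
HB.instance Definition _ := [Choice of adjoin_ring z by <:].
HB.instance Definition _ := [SubChoice_isSubComNzRing of adjoin_ring z by <:].

Lemma adjoin_const_in v : iota v \in adjoin z.
Proof. by apply/asboolP; exists v%:P; rewrite map_polyC hornerC. Qed.

Definition adjoin_const_fun v : adjoin_ring z := AdjoinRing (adjoin_const_in v).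

Lemma adjoin_const_zmod : zmod_morphism adjoin_const_fun.
Proof. by move=> v w; apply: val_inj; rewrite /= rmorphB. Qed.
Lemma adjoin_const_monoid : monoid_morphism adjoin_const_fun.
Proof. by split=> [|v w]; apply: val_inj; rewrite /= ?rmorph1 ?rmorphM. Qed.
HB.instance Definition _ :=
  GRing.isZmodMorphism.Build V (adjoin_ring z) adjoin_const_fun adjoin_const_zmod.
HB.instance Definition _ :=
  GRing.isMonoidMorphism.Build V (adjoin_ring z) adjoin_const_fun adjoin_const_monoid.
Definition adjoin_const : {rmorphism V -> adjoin_ring z} := adjoin_const_fun.
End Structure.

Section Inclusion.
Variables (y z : K) (n : nat) (yz : z ^+ n = y).

Lemma adjoin_sub x : x \in adjoin y -> x \in adjoin z.
Proof.
move=> /asboolP[f ->]; apply/asboolP; exists (f \Po 'X^n).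
by rewrite map_comp_poly map_polyXn horner_comp hornerXn yz.
Qed.

Definition adjoin_incl_fun & z ^+ n = y := fun x : adjoin_ring y =>
  AdjoinRing (adjoin_sub (adjoin_valP x)).

Lemma adjoin_incl_zmod : zmod_morphism (adjoin_incl_fun yz).
Proof. by move=> u v; apply: val_inj. Qed.
Lemma adjoin_incl_monoid : monoid_morphism (adjoin_incl_fun yz).
Proof. by split=> [|u v]; apply: val_inj. Qed.
HB.instance Definition _ :=
  GRing.isZmodMorphism.Build _ _ (adjoin_incl_fun yz) adjoin_incl_zmod.
HB.instance Definition _ :=
  GRing.isMonoidMorphism.Build _ _ (adjoin_incl_fun yz) adjoin_incl_monoid.
Definition adjoin_incl : {rmorphism adjoin_ring y -> adjoin_ring z} := adjoin_incl_fun yz.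

Lemma adjoin_incl_const v : adjoin_incl (adjoin_const y v) = adjoin_const z v.
Proof. exact: val_inj. Qed.
End Inclusion.

End Adjoin.

Record tower := Tower {
  tower_ring :> nat -> comPzRingType;
  tower_map : forall i, {rmorphism tower_ring i -> tower_ring i.+1} }.

(* The identification of R with the ring of index 0 of the tower is the      *)
(* bijective ring morphism e.                                                *)
Section PerfectoidTowers.
Variables (p : nat) (R : comPzRingType) (I0 : ideal R).
Variables (T : tower) (e : {rmorphism R -> T 0%N}).

Fixpoint from_base (i : nat) : {rmorphism R -> T i} :=
  if i is i'.+1 then tower_map T i' \o from_base i' else e.

Fixpoint from_one (i : nat) : {rmorphism T 1%N -> T i.+1} :=
  if i is i'.+1 then tower_map T i'.+1 \o from_one i' else idfun.

Definition base_ideal (i : nat) : ideal (T i) := ext_ideal (from_base i) I0.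

Definition tower_bar (i : nat) : comPzRingType := quot (base_ideal i).

Lemma base_ideal_map i x : base_ideal i x -> base_ideal i.+1 (tower_map T i x).
Proof. exact: ext_ideal_map. Qed.

Definition tbar (i : nat) : {rmorphism tower_bar i -> tower_bar i.+1} :=
  quot_map (@base_ideal_map i).

Record purely_inseparable_tower : Prop := {
  pit_base : bijective e;
  pit_p : I0 p%:R;
  pit_inj : forall i, injective (tbar i);
  pit_frob : forall i x, exists y, tbar i y = x ^+ p }.

Definition frobenius_projection i (F : {rmorphism tower_bar i.+1 -> tower_bar i}) :=
  forall x, tbar i (F x) = x ^+ p.

Lemma frobenius_projection_uniq i F G : purely_inseparable_tower ->
  @frobenius_projection i F -> @frobenius_projection i G -> F =1 G.
Proof. by case=> _ _ inj _ FP GP x; apply: inj; rewrite FP GP. Qed.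

Definition torsion (i : nat) (x : T i) :=
  exists n, forall a, ideal_exp I0 n a -> from_base i a * x = 0.

Definition torsion_type (i : nat) := {x : T i | torsion x}.

Record perfectoid_axioms (F : forall i, {rmorphism tower_bar i.+1 -> tower_bar i}) :
    Prop := {
  pt_proj : forall i, frobenius_projection (F i);
  pt_surj : forall i y, exists x, F i x = y;
  pt_jacobson : forall i x, base_ideal i x -> in_jacobson x;
  pt_principal : exists a, eq_ideal I0 (principal a);
  pt_root : exists b : T 1%N,
    eq_ideal (ideal_exp (principal b) p) (base_ideal 1) /\
    forall i x, F i x = 0 <->
      ext_ideal (fun y => quot_pi (base_ideal i.+1) (from_one i y)) (principal b) x;
  pt_torsion : forall i,
    (forall a x, I0 a -> torsion x -> from_base i a * x = 0) /\
    exists! G : torsion_type i.+1 -> torsion_type i, bijective G /\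
      forall x, F i (quot_pi (base_ideal i.+1) (sval x)) =
        quot_pi (base_ideal i) (sval (G x)) }.

Definition perfectoid_tower : Prop :=
  purely_inseparable_tower /\ exists F, perfectoid_axioms F.

End PerfectoidTowers.

Section ReducedTower.
Variables (p : nat) (p_pr : prime p) (k : comNzRingType) (m n : nat).
Local Notation V := (witt p_pr k).
Local Notation A := (mpseries m V).
Variables (eps : 'I_n -> 'I_m.+1 -> bool) (d : delta_structure p A).
Hypothesis d_var : forall i, d (mps_var i) = 0.
Variables (K : fieldType) (iota : {rmorphism V -> K}) (pi : p_power_roots p K).

Definition monomial_quotient : comPzRingType := quot (monomial_ideal p_pr k eps).

Definition phiR : {rmorphism monomial_quotient -> monomial_quotient} :=
  quot_map (@monomial_ideal_stable p p_pr k m d d_var n eps).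

Definition colim_ring (i : nat) : comPzRingType := chain_colim phiR i.

Definition root_ring (i : nat) : comNzRingType := adjoin_ring iota (pi i).

Definition coef_map : {rmorphism V -> monomial_quotient} :=
  quot_pi (monomial_ideal p_pr k eps) \o @mps_const m V.

Definition colim_alg (i : nat) : {rmorphism V -> colim_ring i} := chain_leg phiR ord0 \o coef_map.

Lemma colim_alg_next i v : chain_next phiR i (colim_alg i v) = colim_alg i.+1 v.
Proof. exact: (chain_nextE phiR (ord0 : 'I_i.+1) (coef_map v)). Qed.

Definition tensor_ring (i : nat) : comPzRingType := tensor (colim_alg i) (adjoin_const iota (pi i)).

Definition tensor_next (i : nat) : {rmorphism tensor_ring i -> tensor_ring i.+1} :=
  tensor_map (@colim_alg_next i) (adjoin_incl_const iota (prootS pi i)).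

Definition reduced_tower : tower := {|
  tower_ring i := quot (nilradical (tensor_ring i));
  tower_map i := quot_map (@nilradical_map _ _ (tensor_next i)) |}.

Definition reduced_tower_base : {rmorphism monomial_quotient -> reduced_tower 0%N} :=
  quot_pi (nilradical (tensor_ring 0)) \o tensor_inl (colim_alg 0) (adjoin_const iota (pi 0%N)).

End ReducedTower.

(* Main.v *)
From HB Require Import structures.
Require Import Defs.
From mathcomp Require Import all_boot all_order all_algebra.
From mathcomp Require Import boolp ring.
From mathcomp Require mpoly mxpoly.

Set Implicit Arguments.
Unset Strict Implicit.
Unset Printing Implicit Defensive.

Import GRing.Theory.
Local Open Scope ring_scope.

(** Why the tower is perfectoid.

    Put [q = p^i] and let [t] be the chosen [q]-th root of [p].  The extension
    [V_i] is [V[t]/(t^q - p)], free over [V] on the powers of [t], because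
    [t^q - p] is Eisenstein ([root_free]).  Freeness survives the base change
    to [R_i], which is a copy of [R] ([tensor_radical_ext]), so the ring
    [B_i = R_i (x)_V V_i] is [R[t]/(t^q - p)]: the Frobenius twist in the
    structure map of [R_i] disappears, since that map fixes [p].  The
    transition maps raise [t] to the power [p] and apply [phi_R] to the
    coefficients.

    Everything else depends on a few properties of [R] ([p_reduced]): its
    [p]-power torsion is killed by [p], it is [p]-adically separated and
    complete, and both [R/p] and [R/(R[p] + pR)] are reduced.  They imply that
    [sum_j r_j t^j] is nilpotent in [B_i] exactly when [r_0 = 0] and
    [p r_j = 0] for all [j] ([nilradicalP]).  Hence the reduction [T_i] is [R]
    in degree [0] and [R/R[p]] in the degrees [0 < j < q], and the vanishing of
    an element of [T_i/p] can be read off its coefficients ([bar_eq0]).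

    Since [phi_R] is the Frobenius modulo [p], the transition map modulo [p]
    sends the class of [sum_j r_j t_i^j] to the [p]-th power of the class of
    [sum_j r_j t_(i+1)^j] ([tbar_power_sum]).  So it is injective, its image
    contains the [p]-th powers, and the Frobenius projection merely replaces
    [t_(i+1)] by [t_i].  It is therefore surjective, its kernel is generated by
    [t_(i+1)^(p^i) = t_1], and it fixes the image of [R]; the torsion of every
    [T_i] is [R[p]], placed in degree [0], on which the projections are the
    identity.

    It remains to check the properties of [R = A/I].  A power series lies in
    [I] exactly when each of its coefficients lies in an ideal of [W(k)] among
    the unit ideal, [(p)] and [0], which depends only on which variables divide
    the monomial ([monomial_idealP]); the monomials [x^u] and [x^(pu)] involve
    the same variables.  Modulo [p] the coefficient of [x^(pu)] in [a^p] is the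
    [p]-th power of the coefficient of [x^u] in [a], so both quotients are
    reduced because [k] is.  The other properties hold coefficient by
    coefficient, as [W(k)] is [p]-torsion free, separated and complete. *)

(** * Witt vectors of a perfect field *)

Section GhostCongruence.
Import WittPoly.
Variables (p : nat) (p_pr : prime p) (P : comNzRingType).
Hypothesis P_torsion_free : forall c (f : P), (0 < c)%N -> c%:R * f = 0 -> f = 0.

Lemma ghost_inj_upto N (x y : nat -> P) :
  (forall n, (n < N)%N -> ghost p n x = ghost p n y) ->
  forall n, (n < N)%N -> x n = y n.
Proof.
move=> xy n; have [m] := ubnP n; elim: m n => // m IH n; rewrite ltnS => lenm nN.
apply/eqP; rewrite -subr_eq0; apply/eqP.
apply: (P_torsion_free (c := p ^ n)); first by rewrite expn_gt0 prime_gt0.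
have := xy n nN; rewrite !ghost_recr.
rewrite (eq_bigr (fun i : 'I_n => (p ^ i)%:R * y i ^+ (p ^ (n - i)))).
  by move/addrI => E; rewrite mulrBr E subrr.
by move=> i _; rewrite IH // ?(leq_trans _ lenm) // (ltn_trans _ nN).
Qed.

(** The converse of the usual congruence for ghost components: dividing the
    [n]-th equation by [p^n] leaves a congruence modulo [p]. *)
Lemma pcong_of_ghost (x y : nat -> P) :
  (forall n, pcong p n.+1 (ghost p n x) (ghost p n y)) ->
  forall n, pcong p 1 (x n) (y n).
Proof.
move=> xy n; have [m] := ubnP n; elim: m n => // m IH n; rewrite ltnS => lenm.
have [q E] := xy n; rewrite !ghost_recr in E.
have [r E'] : pcong p n.+1 (\sum_(i < n) (p ^ i)%:R * x i ^+ (p ^ (n - i)))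
    (\sum_(i < n) (p ^ i)%:R * y i ^+ (p ^ (n - i))).
  apply: pcong_sum => i.
  have [|r Er] := pcongXX p_pr (n - i) (IH i _); first exact: leq_trans lenm.
  exists r; rewrite -mulrBr Er mulrA -natrM -expnD addnS subnKC //.
  exact: ltnW.
exists (q - r); apply/eqP; rewrite -subr_eq0; apply/eqP.
apply: (P_torsion_free (c := p ^ n)); first by rewrite expn_gt0 prime_gt0.
rewrite mulrBr mulrA -natrM -expnD addn1 [X in _ - X]mulrBr -E -E'.
set a := \sum_(_ < _) _; set b := \sum_(_ < _) _; ring.
Qed.

(** Verschiebung composed with the Frobenius of the coordinates: in
    characteristic [p] this is multiplication by [p]. *)
Definition frob_shift (x : nat -> P) n := if n is n'.+1 then x n' ^+ p else 0.

Lemma ghost_frob_shift (x y : nat -> P) n :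
  ghost p n x = p%:R * ghost p n y -> pcong p n.+1 (ghost p n x) (ghost p n (frob_shift y)).
Proof.
move=> ->; exists (y n); rewrite ghost_recr [in X in _ - X]/ghost big_ord_recl /=.
rewrite subn0 expr0n gtn_eqF ?expn_gt0 ?prime_gt0 // mulr0 add0r.
rewrite [X in _ - X](eq_bigr (fun i : 'I_n => p%:R * ((p ^ i)%:R * y i ^+ (p ^ (n - i))))).
  by rewrite -mulr_sumr expnS natrM; ring.
move=> i _; rewrite /bump /= add1n -exprM -expnS -subSn ?subSS //.
by rewrite expnS natrM mulrA.
Qed.

End GhostCongruence.

Lemma rmorph_pcong (p : nat) (P k : comNzRingType) (r : {rmorphism P -> k}) f g :
  p \in [pchar k] -> WittPoly.pcong p 1 f g -> r f = r g.
Proof.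
move=> pk [q fg]; apply/eqP; rewrite -subr_eq0 -rmorphB fg rmorphM rmorph_nat.
by rewrite expn1 (pcharf0 pk) mul0r.
Qed.

Lemma witt_ghostB (p : nat) (p_pr : prime p) (k : comNzRingType) n (x y : witt p_pr k) :
  witt_ghost n (x - y) = witt_ghost n x - witt_ghost n y.
Proof. by rewrite [LHS]witt_ghostD witt_ghostN. Qed.

Lemma wcoef_agreeB_torsion_free (p : nat) (p_pr : prime p) (P : comNzRingType) N
    (x y x' y' : witt p_pr P) :
  (forall c (f : P), (0 < c)%N -> c%:R * f = 0 -> f = 0) ->
  (forall i, (i < N)%N -> wcoef x i = wcoef x' i) ->
  (forall i, (i < N)%N -> wcoef y i = wcoef y' i) ->
  forall i, (i < N)%N -> wcoef (x - y) i = wcoef (x' - y') i.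
Proof.
move=> P_tf xx yy i iN; apply: (ghost_inj_upto p_pr P_tf _ iN) => j jN.
rewrite -[LHS]/(witt_ghost j (x - y)) -[RHS]/(witt_ghost j (x' - y')) !witt_ghostB.
by congr (_ - _); apply: WittPoly.eq_ghost => l lj; [apply: xx | apply: yy];
  exact: leq_ltn_trans lj jN.
Qed.

Section Witt.
Import WittPoly.
Variables (p : nat) (p_pr : prime p).

Let generic_witt a : witt p_pr wpoly := Witt p_pr (wvar a).

Let wpoly_torsion_free c (f : wpoly) : (0 < c)%N -> c%:R * f = 0 -> f = 0.
Proof. exact: torsion_free wpoly_quoK c f. Qed.

(** Witt vectors over any ring are values of generic ones, whose coordinates are
    variables of a torsion free ring, where ghost components decide equality. *)
Let wev (k : comNzRingType) (e : nat -> witt p_pr k) :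
    {rmorphism witt p_pr wpoly -> witt p_pr k} :=
  witt_map p_pr (weval (fun a n => wcoef (e a) n)).

Lemma wevE (k : comNzRingType) (e : nat -> witt p_pr k) x i :
  wcoef (wev e x) i = weval (fun a n => wcoef (e a) n) (wcoef x i).
Proof. by []. Qed.

Lemma wev_generic_witt (k : comNzRingType) (e : nat -> witt p_pr k) a : wev e (generic_witt a) = e a.
Proof. by apply: wittP => n; rewrite wevE /= weval_var. Qed.

Lemma wcoef_mulp (k : comNzRingType) (x : witt p_pr k) n : p \in [pchar k] ->
  wcoef (p%:R * x) n = if n is n'.+1 then wcoef x n' ^+ p else 0.
Proof.
move=> pk.
have [q E] : pcong p 1 (wcoef (p%:R * generic_witt 0) n) (frob_shift p (wcoef (generic_witt 0)) n).
  apply: (pcong_of_ghost p_pr wpoly_torsion_free) => {}n; apply: ghost_frob_shift => //.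
  by rewrite -[LHS]/(witt_ghost n _) rmorphM rmorph_nat.
have {}E : weval (fun=> wcoef x) (wcoef (p%:R * generic_witt 0) n) =
    weval (fun=> wcoef x) (frob_shift p (wcoef (generic_witt 0)) n).
  exact: (rmorph_pcong (weval (fun=> wcoef x)) pk (ex_intro _ q E)).
transitivity (weval (fun=> wcoef x) (wcoef (p%:R * generic_witt 0) n)).
  by rewrite -[RHS](wevE (fun=> x)) rmorphM rmorph_nat wev_generic_witt.
rewrite E; case: n {E} => [|n]; first exact: (rmorph0 (weval _)).
transitivity (weval (fun=> wcoef x) (wvar 0 n) ^+ p); last by rewrite weval_var.
exact: (rmorphXn (weval _)).
Qed.

(** The first [N] coordinates of a difference only depend on the first [N]
    coordinates of its terms. *)
Lemma wcoef_agreeB (k : comNzRingType) N (x y x' y' : witt p_pr k) :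
  (forall i, (i < N)%N -> wcoef x i = wcoef x' i) ->
  (forall i, (i < N)%N -> wcoef y i = wcoef y' i) ->
  forall i, (i < N)%N -> wcoef (x - y) i = wcoef (x' - y') i.
Proof.
move=> xx yy.
pose e a := if a is 0%N then x else if a is 1%N then y else if a is 2%N then x' else y'.
(* cut a b follows the variables a below N and the variables b from N on *)
pose cut a b : witt p_pr wpoly := Witt p_pr (fun i => if (i < N)%N then wvar a i else wvar b i).
have cutE a b : (forall i, (i < N)%N -> wcoef (e a) i = wcoef (e b) i) ->
    wev e (cut a b) = e b.
  move=> ab; apply: wittP => i; rewrite wevE /=.
  by case: ifP => iN; rewrite weval_var ?ab.
have e0 : wev e (generic_witt 0) = x by exact: wev_generic_witt.
have e1 : wev e (generic_witt 1) = y by exact: wev_generic_witt.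
have e2 : wev e (cut 0%N 2%N) = x' by exact: cutE.
have e3 : wev e (cut 1%N 3%N) = y' by exact: cutE.
rewrite -e0 -e1 -e2 -e3 -(rmorphB (wev e)) -(rmorphB (wev e)).
move=> i iN; apply: (congr1 (weval (fun a n => wcoef (e a) n))).
have cut_agree a b j : (j < N)%N -> wcoef (generic_witt a) j = wcoef (cut a b) j.
  by move=> jN /=; rewrite jN.
by apply: wcoef_agreeB_torsion_free iN => //; apply: cut_agree.
Qed.

End Witt.

(** * p-adically complete rings *)

Section Padic.
Variable p : nat.

Definition pdvd (R : comPzRingType) n (x : R) := exists y, x = (p ^ n)%:R * y.

Definition p_separated (R : comPzRingType) :=
  forall x : R, (forall n, pdvd n x) -> x = 0.

Definition psum (R : comPzRingType) (w : nat -> R) n : R := \sum_(l < n) (p ^ l)%:R * w l.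

Definition p_complete (R : comPzRingType) :=
  forall w : nat -> R, exists s, forall n, pdvd n (s - psum w n).

Section Theory.
Variable R : comPzRingType.
Implicit Types x y : R.

Lemma pdvd0 n : pdvd n (0 : R).
Proof. by exists 0; rewrite mulr0. Qed.

Lemma pdvdD n x y : pdvd n x -> pdvd n y -> pdvd n (x + y).
Proof. by move=> [x' ->] [y' ->]; exists (x' + y'); rewrite mulrDr. Qed.

Lemma pdvdMl n x y : pdvd n x -> pdvd n (y * x).
Proof. by move=> [x' ->]; exists (y * x'); rewrite mulrCA. Qed.

Lemma pdvdN n x : pdvd n x -> pdvd n (- x).
Proof. by rewrite -mulN1r; apply: pdvdMl. Qed.

Lemma pdvdB n x y : pdvd n x -> pdvd n y -> pdvd n (x - y).
Proof. by move=> nx /pdvdN; apply: pdvdD. Qed.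

Lemma pdvd_mulp n x : pdvd n ((p ^ n)%:R * x).
Proof. by exists x. Qed.

Lemma pdvd1 x : pdvd 1 x <-> exists y, x = p%:R * y.
Proof. by rewrite /pdvd expn1. Qed.

Lemma pdvd_sum n (I : Type) (s : seq I) (P : pred I) (F : I -> R) :
  (forall i, P i -> pdvd n (F i)) -> pdvd n (\sum_(i <- s | P i) F i).
Proof.
by move=> nF; elim/big_ind: _ => //; [exact: pdvd0 | exact: pdvdD].
Qed.

Lemma p_separatedP x y : p_separated R -> (forall n, pdvd n (x - y)) -> x = y.
Proof. by move=> sep xy; apply/eqP; rewrite -subr_eq0; apply/eqP/sep. Qed.

Lemma psum_cauchy (w : nat -> R) i n : (i <= n)%N -> pdvd i (psum w n - psum w i).
Proof.
move=> /subnKC <-; elim: (n - i)%N => [|r IH]; first by rewrite addn0 subrr; apply: pdvd0.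
rewrite addnS /psum big_ord_recr -/(psum _ _) addrAC; apply: pdvdD => //.
by rewrite expnD natrM -mulrA; exists ((p ^ r)%:R * w (i + r)).
Qed.

(** Geometric series: the inverse of [1 - p x] is the sum of the [p^l x^l]. *)
Lemma p_complete_inv x : p_separated R -> p_complete R -> exists y, (1 - p%:R * x) * y = 1.
Proof.
move=> sep /(_ (fun l => x ^+ l)) [s sP]; exists s; apply: p_separatedP => // n.
have := sP n; set sn := psum _ n => ssn.
have E : (1 - p%:R * x) * sn = 1 - (p ^ n)%:R * x ^+ n.
  rewrite natrX -exprMn; apply: oppr_inj; rewrite -mulNr !opprB subrX1.
  by congr (_ * _); apply: eq_bigr => l _; rewrite exprMn natrX.
have -> : (1 - p%:R * x) * s - 1 = (1 - p%:R * x) * (s - sn) - (p ^ n)%:R * x ^+ n.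
  by rewrite mulrBr E; ring.
by apply: pdvdB; [apply: pdvdMl | apply: pdvd_mulp].
Qed.

End Theory.
End Padic.

Section PerfectWitt.
Variables (p : nat) (p_pr : prime p) (k : fieldType) (pk : p \in [pchar k]).
Hypothesis k_perfect : forall a : k, exists b : k, b ^+ p = a.
Local Notation V := (witt p_pr k).
Implicit Types x y : V.

Lemma wcoef_mulpn n x i : wcoef ((p ^ n)%:R * x) i = 
  if (i < n)%N then 0 else wcoef x (i - n) ^+ (p ^ n).
Proof.
elim: n i => [|n IH] i; first by rewrite expn0 mul1r subn0 expr1.
rewrite expnS natrM -mulrA wcoef_mulp //; case: i => [|i] //.
rewrite IH ltnS subSS; case: ifP => _; first by rewrite expr0n gtn_eqF ?prime_gt0.
by rewrite -exprM mulnC.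
Qed.

Lemma perfect_root n (a : k) : exists b, b ^+ (p ^ n) = a.
Proof.
elim: n a => [|n IH] a; first by exists a; rewrite expr1.
have [b <-] := k_perfect a; have [c <-] := IH b.
by exists c; rewrite expnSr exprM.
Qed.

(** As [k] is perfect, [p^n W(k)] is all of [V^n W(k)]: the [p]-adic topology is
    that of the coordinates. *)
Lemma witt_pdvdP n x : pdvd p n x <-> (forall i, (i < n)%N -> wcoef x i = 0).
Proof.
split=> [[y ->] i lt|x0]; first by rewrite wcoef_mulpn lt.
pose r i := sval (cid (perfect_root n (wcoef x (i + n)))).
exists (Witt p_pr r); apply: wittP => i; rewrite wcoef_mulpn.
case: ltnP => [/x0 //|le] /=.
by rewrite /r; case: cid => b /= ->; rewrite subnK.
Qed.

Lemma witt_agreeP n x y :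
  (forall i, (i < n)%N -> wcoef x i = wcoef y i) <-> pdvd p n (x - y).
Proof.
rewrite witt_pdvdP; split=> xy i lt.
  by rewrite (wcoef_agreeB (x' := y) (y' := y) xy) // subrr.
have := wcoef_agreeB (x := x - y) (x' := 0) (y := - y) (y' := - y) xy (fun _ _ => erefl) lt.
by rewrite sub0r !opprK subrK.
Qed.

Lemma witt_p_torsion_free x : p%:R * x = 0 -> x = 0.
Proof.
move=> px; apply: wittP => i; have := congr1 (fun y => wcoef y i.+1) px.
by rewrite wcoef_mulp //= => /eqP; rewrite expf_eq0 => /andP[_ /eqP].
Qed.

Lemma witt_p_separated : p_separated p V.
Proof.
by move=> x px; apply: wittP => i; apply: (witt_pdvdP i.+1 x).1.
Qed.

(** The [i]-th coordinate of the partial sums is constant from the rank [i.+1] on,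
    which gives the coordinates of the sum. *)
Lemma witt_p_complete : p_complete p V.
Proof.
move=> w; exists (Witt p_pr (fun i => wcoef (psum p w i.+1) i)) => n.
apply/witt_agreeP => i lt /=; symmetry.
exact: (witt_agreeP i.+1 _ _).2 (psum_cauchy p w lt) i (ltnSn i).
Qed.

Lemma witt_pdvd1P x : pdvd p 1 x <-> witt_ghost 0 x = 0.
Proof.
rewrite witt_pdvdP /witt_ghost WittPoly.ghost_recr big_ord0 add0r mul1r.
by split=> [|x0 [|//]]; first exact.
Qed.

End PerfectWitt.

(** * Adjoining a root of [p] *)

Section PowerSums.
Variables (R B : comPzRingType) (f : {rmorphism R -> B}) (t : B) (q : nat).
Implicit Types c d : nat -> R.

Definition power_sum c : B := \sum_(j < q) f (c j) * t ^+ j.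

Lemma eq_power_sum c d : (forall j, (j < q)%N -> c j = d j) -> power_sum c = power_sum d.
Proof. by move=> cd; apply: eq_bigr => j _; rewrite cd. Qed.

Lemma power_sum0 : power_sum (fun=> 0) = 0.
Proof. by rewrite /power_sum big1 // => j _; rewrite rmorph0 mul0r. Qed.

Lemma power_sumD c d : power_sum (fun j => c j + d j) = power_sum c + power_sum d.
Proof. by rewrite -big_split; apply: eq_bigr => j _; rewrite rmorphD mulrDl. Qed.

Lemma power_sumN c : power_sum (fun j => - c j) = - power_sum c.
Proof. by rewrite -sumrN; apply: eq_bigr => j _; rewrite rmorphN mulNr. Qed.

Lemma power_sumB c d : power_sum (fun j => c j - d j) = power_sum c - power_sum d.
Proof. by rewrite power_sumD power_sumN. Qed.

Lemma power_sumZ a c : power_sum (fun j => a * c j) = f a * power_sum c.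
Proof. by rewrite mulr_sumr; apply: eq_bigr => j _; rewrite rmorphM mulrA. Qed.

Lemma power_sumMn n c : power_sum (fun j => n%:R * c j) = n%:R * power_sum c.
Proof. by rewrite power_sumZ rmorph_nat. Qed.

Lemma power_sum_monom a l : (l < q)%N ->
  power_sum (fun j => if j == l then a else 0) = f a * t ^+ l.
Proof.
move=> lq; rewrite /power_sum (bigD1 (Ordinal lq)) //= eqxx big1 ?addr0 // => j.
by rewrite -val_eqE /= => /negPf ->; rewrite rmorph0 mul0r.
Qed.

End PowerSums.

Lemma power_sum_cat (R B : comPzRingType) (f : {rmorphism R -> B}) (t : B) n m c :
  power_sum f t (n + m) c =
    power_sum f t n c + t ^+ n * power_sum f t m (fun j => c (n + j)%N).
Proof.
rewrite /power_sum big_split_ord mulr_sumr /=; congr (_ + _).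
by apply: eq_bigr => j _; rewrite exprD mulrCA.
Qed.

Lemma power_sum_widen (R B : comPzRingType) (f : {rmorphism R -> B}) (t : B) n m c :
  (n <= m)%N -> power_sum f t n c = power_sum f t m (fun j => if (j < n)%N then c j else 0).
Proof.
move=> /subnKC <-; rewrite power_sum_cat [X in _ = _ + _ * X](_ : _ = 0).
  by rewrite mulr0 addr0; apply: eq_power_sum => j ->.
rewrite -(power_sum0 f t (m - n)); apply: eq_power_sum => j _.
by rewrite ltnNge leq_addr.
Qed.

(** [B] is [R[t]/(t^q - p)]; polynomials are avoided as [R] may be the zero ring. *)
Record radical_ext (p q : nat) (R B : comPzRingType) (f : {rmorphism R -> B}) (t : B) :
    Prop := RadicalExt {
  rx_root : t ^+ q = p%:R;
  rx_span : forall z, exists c, z = power_sum f t q c;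
  rx_free : forall c, power_sum f t q c = 0 -> forall j, (j < q)%N -> c j = 0 }.

Lemma radical_ext_inj (p q : nat) (R B : comPzRingType) (f : {rmorphism R -> B}) (t : B) c d :
  radical_ext p q f t -> power_sum f t q c = power_sum f t q d ->
  forall j, (j < q)%N -> c j = d j.
Proof.
move=> rx cd j jq; apply/eqP; rewrite -subr_eq0; apply/eqP.
by apply: (rx_free rx (c := fun j => c j - d j)) => //; rewrite power_sumB cd subrr.
Qed.

Section Eisenstein.
Variables (p : nat) (V : comNzRingType) (K : fieldType) (iota : {rmorphism V -> K}).
Hypothesis iota_inj : injective iota.

(** Multiplying an integral equation of degree [n] for [1/p] by [p^n] writes [1]
    as a multiple of [p] in [V]. *)
Lemma inv_p_not_integral (w : K) :
  mxpoly.integralOver iota w -> p%:R * w = 1 -> pdvd p 1 (1 : V).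
Proof.
case=> g g_monic /rootP g0 pw.
move: g0; rewrite horner_coef size_map_inj_poly ?rmorph0 //.
rewrite polySpred ?monic_neq0 // big_ord_recr /=; set n := (size g).-1.
have -> : (map_poly iota g)`_n = 1.
  by rewrite coef_map (monicP g_monic : g`_n = 1); apply: rmorph1.
rewrite mul1r => g0.
exists (- \sum_(i < n) g`_i * (p ^ (n - i.+1))%:R).
apply: iota_inj; rewrite rmorph1 expn1 mulrN rmorphN; apply/eqP; rewrite -addr_eq0.
have <- : p%:R ^+ n * (\sum_(i < n) (map_poly iota g)`_i * w ^+ i + w ^+ n) =
    1 + iota (p%:R * (\sum_(i < n) g`_i * (p ^ (n - i.+1))%:R)).
  rewrite mulrDr -exprMn pw expr1n addrC; congr (_ + _).
  rewrite !mulr_sumr rmorph_sum; apply: eq_bigr => i _.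
  rewrite [p%:R * (_ * _)]mulrCA -natrM -expnS -subSn ?subSS // rmorphM rmorph_nat coef_map.
  rewrite mulrCA; congr (_ * _).
  by rewrite -{1}(subnK (ltnW (ltn_ord i))) exprD -mulrA -exprMn pw expr1n mulr1 natrX.
by rewrite g0 mulr0.
Qed.

Hypothesis p_reg : forall v : V, p%:R * v = 0 -> v = 0.
Hypothesis V_sep : p_separated p V.
Hypothesis p_nonunit : ~ pdvd p 1 (1 : V).
Hypothesis V_local : forall v : V, ~ pdvd p 1 v -> exists w, v * w = 1.

Variables (z : K) (q : nat).
Hypotheses (q_gt0 : (0 < q)%N) (zq : z ^+ q = p%:R).

Lemma root_Xnsub_p : root (map_poly iota ('X^q - p%:R%:P)) z.
Proof.
rewrite rmorphB /= map_polyXn map_polyC; apply/rootP.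
rewrite hornerD hornerN hornerXn hornerC zq; apply/eqP; rewrite subr_eq0; apply/eqP.
exact/esym/rmorph_nat.
Qed.

Lemma root_integral : mxpoly.integralOver iota z.
Proof. by exists ('X^q - p%:R%:P); [exact: monicXnsubC | exact: root_Xnsub_p]. Qed.

Lemma p_neq0_field : (p%:R : K) != 0.
Proof.
apply/eqP => p0; have /eqP : (1 : V) = 0; last by rewrite oner_eq0.
by apply: p_reg; apply: iota_inj; rewrite mulr1 rmorph_nat p0 rmorph0.
Qed.

Lemma root_neq0 : z != 0.
Proof.
by apply: contraNneq p_neq0_field => z0; rewrite -zq z0 expr0n gtn_eqF.
Qed.

Lemma integralOver_sum (I : Type) (s : seq I) (F : I -> K) :
  (forall i, mxpoly.integralOver iota (F i)) -> mxpoly.integralOver iota (\sum_(i <- s) F i).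
Proof.
move=> FP; elim/big_ind: _ => //; first exact: mxpoly.integral0.
exact: mxpoly.integral_add.
Qed.

Lemma integralOver_exp (x : K) n : mxpoly.integralOver iota x -> mxpoly.integralOver iota (x ^+ n).
Proof.
move=> xP; elim: n => [|n IH]; first exact: mxpoly.integral1.
by rewrite exprS; apply: mxpoly.integral_mul.
Qed.

(** Eisenstein's argument: if [c j] is the first coefficient not divisible by
    [p], then it is a unit, and the relation makes it [z] times an integral
    element [- S]; so [z], hence [p = z^q], has an integral inverse. *)
Lemma root_relation_pdvd (c : nat -> V) : \sum_(j < q) iota (c j) * z ^+ j = 0 ->
  forall j, (j < q)%N -> pdvd p 1 (c j).
Proof.
move=> c0 j; have [n] := ubnP j; elim: n j => // n IH j; rewrite ltnS => jn jq.
apply: contrapT => /V_local [w cw].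
have /choice [s sP] (l : 'I_q) : exists s, mxpoly.integralOver iota s /\
    (l != Ordinal jq -> iota (c l) * z ^+ l = z ^+ j.+1 * s).
  have [ltlj|ltjl|lj] := ltngtP l j.
  - have /pdvd1 [y cy] := IH l (leq_trans ltlj jn) (ltn_ord l).
    exists (iota y * z ^+ (q - j.+1) * z ^+ l); split=> [|_].
      by rewrite -mulrA -exprD; apply: mxpoly.integral_mul;
        [apply: mxpoly.integral_id | apply/integralOver_exp/root_integral].
    by rewrite cy rmorphM rmorph_nat -zq -{1}(subnK jq) exprD; ring.
  - exists (iota (c l) * z ^+ (l - j.+1)); split=> [|_].
      by apply: mxpoly.integral_mul;
        [apply: mxpoly.integral_id | apply/integralOver_exp/root_integral].
    by rewrite mulrCA -exprD subnKC.
  - by exists 0; split=> [|/eqP[]]; [exact: mxpoly.integral0 | exact: val_inj].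
pose S := \sum_(l < q | l != Ordinal jq) s l.
have S_int : mxpoly.integralOver iota S.
  by rewrite /S -big_filter; apply: integralOver_sum => l; have [] := sP l.
have E : iota (c j) = z * - S.
  apply: (mulIf (expf_neq0 j root_neq0)).
  move: c0; rewrite (bigD1 (Ordinal jq)) //=.
  under eq_bigr => l lj do rewrite ((sP l).2 lj).
  rewrite -mulr_sumr -/S => /eqP; rewrite addr_eq0 => /eqP ->.
  by rewrite exprS; ring.
apply: p_nonunit; apply: (inv_p_not_integral (w := (- S * iota w) ^+ q)).
  apply: integralOver_exp; apply: mxpoly.integral_mul; last exact: mxpoly.integral_id.
  exact: mxpoly.integral_opp.
by rewrite -zq -exprMn mulrA -E -rmorphM cw rmorph1 expr1n.
Qed.

(** Dividing a relation by [p] gives another relation, so its coefficients are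
    divisible by all the powers of [p]. *)
Lemma root_free (c : nat -> V) : \sum_(j < q) iota (c j) * z ^+ j = 0 ->
  forall j, (j < q)%N -> c j = 0.
Proof.
move=> c0 j jq; apply: V_sep => n.
suff [d cd] : exists d : nat -> V, forall j, (j < q)%N -> c j = (p ^ n)%:R * d j by exists (d j); apply: cd.
suff [d [_ cd]] : exists d : nat -> V, \sum_(j < q) iota (d j) * z ^+ j = 0 /\
    forall j, (j < q)%N -> c j = (p ^ n)%:R * d j by exists d.
elim: n => [|n [d [d0 cd]]].
  by exists c; split=> // l _; rewrite mul1r.
have /choice [e eP] l : exists y, (l < q)%N -> d l = p%:R * y.
  have [/(root_relation_pdvd d0) /pdvd1 [y ->]|_] := ltnP l q; last by exists 0.
  by exists y.
exists e; split=> [|l lq]; last by rewrite cd // eP // expnSr natrM mulrA.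
apply: (mulfI p_neq0_field); rewrite mulr0 -[RHS]d0 mulr_sumr; apply: eq_bigr => l _.
by rewrite [d l]eP // rmorphM rmorph_nat mulrA.
Qed.

Lemma adjoin_radical_ext (zA : adjoin_ring iota z) : adjoin_val zA = z ->
  radical_ext p q (adjoin_const iota z) zA.
Proof.
move=> zE; pose v : {rmorphism adjoin_ring iota z -> K} := \val.
have vsum c : v (power_sum (adjoin_const iota z) zA q c) = \sum_(j < q) iota (c j) * z ^+ j.
  rewrite rmorph_sum; apply: eq_bigr => j _; rewrite rmorphM rmorphXn.
  by congr (_ * _ ^+ _).
split=> [|y|c c0].
- by apply: (val_inj : injective v); rewrite rmorphXn rmorph_nat -zq; congr (_ ^+ _).
- have /asboolP [g gE] := adjoin_valP y.
  have g_monic : ('X^q - p%:R%:P : {poly V}) \is monic by exact: monicXnsubC.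
  pose r := Pdiv.Ring.rmodp g ('X^q - p%:R%:P).
  have r_size : (size r <= q)%N.
    by rewrite -ltnS -(size_XnsubC (p%:R : V) q_gt0) Pdiv.Ring.ltn_rmodpN0 // monic_neq0.
  exists (fun j => r`_j); apply: (val_inj : injective v); rewrite vsum.
  rewrite -[LHS]/(adjoin_val y) gE (Pdiv.RingMonic.rdivp_eq g_monic g) -/r.
  rewrite rmorphD rmorphM hornerD hornerM (rootP root_Xnsub_p) mulr0 add0r.
  rewrite (horner_coef_wide z (n := q)); last exact: leq_trans (size_poly _ _) r_size.
  by apply: eq_bigr => j _; rewrite coef_map.
- by apply: root_free; rewrite -vsum c0 rmorph0.
Qed.

End Eisenstein.

Section TensorRadical.
Variables (p q : nat) (V R C : comPzRingType).
Variables (f : {rmorphism V -> R}) (g : {rmorphism V -> C}) (t : C).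
Hypothesis g_ext : radical_ext p q g t.
Local Notation inl := (tensor_inl f g : {rmorphism R -> tensor f g}).
Local Notation inr := (tensor_inr f g).

Lemma pureE b c : pure f g b c = inl b * inr c.
Proof. by rewrite /= /tensor_inl /tensor_inr pureM mulr1 mul1r. Qed.

Lemma tensor_span u : exists c, u = power_sum inl (inr t) q c.
Proof.
elim/tensor_piW: u => s; rewrite tensor_piE; elim: s => [|[b c] s [d dE]].
  by exists (fun=> 0); rewrite big_nil power_sum0.
have [v cE] := rx_span g_ext c; exists (fun j => b * f (v j) + d j).
rewrite big_cons power_sumD -dE; congr (_ + _); rewrite power_sumZ pureE; congr (_ * _).
rewrite cE rmorph_sum; apply: eq_bigr => j _; rewrite rmorphM rmorphXn; congr (_ * _).
have := balancedV (pure_balanced f g) (v j) 1 1.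
by rewrite !mulr1.
Qed.

(** The coordinates of [C] over [V] extend to the tensor product, which makes
    the powers of [t] independent over [R]. *)
Lemma tensor_free c : power_sum inl (inr t) q c = 0 -> forall j, (j < q)%N -> c j = 0.
Proof.
have /choice [coord coordE] := rx_span g_ext.
have coord_uniq y d j : y = power_sum g t q d -> (j < q)%N -> coord y j = d j.
  by move=> yE; apply: (radical_ext_inj g_ext); rewrite -coordE.
move=> c0 j jq; have bal : balanced f g (fun b y => b * f (coord y j)).
  split=> [b b' y|b y y'|v b y].
  - exact: mulrDl.
  - rewrite (coord_uniq (y + y') (fun j => coord y j + coord y' j)) ?rmorphD ?mulrDr //.
    by rewrite power_sumD -!coordE.
  - rewrite (coord_uniq (g v * y) (fun j => v * coord y j)) ?rmorphM ?mulrA 1?[b * _]mulrC //.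
    by rewrite power_sumZ -coordE.
have [h [h_add hE]] := tensor_lift bal.
have h0 : h 0 = 0 by have := h_add 0 0; rewrite !subrr.
have hN v : h (- v) = - h v by rewrite -[- v]sub0r h_add h0 sub0r.
have hD u v : h (u + v) = h u + h v by rewrite -{1}[v]opprK h_add hN opprK.
have := congr1 h c0; rewrite h0 /power_sum (big_morph h hD h0).
rewrite (bigD1 (Ordinal jq)) //= big1 ?addr0 => [|l lj].
  rewrite -rmorphXn -pureE hE (coord_uniq _ (fun i => if i == j then 1 else 0)) //.
    by rewrite eqxx rmorph1 mulr1.
  by rewrite power_sum_monom // rmorph1 mul1r.
rewrite -rmorphXn -pureE hE (coord_uniq _ (fun i => if i == l then 1 else 0)) //.
  by move: lj; rewrite -val_eqE /= eq_sym => /negPf ->; rewrite rmorph0 mulr0.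
by rewrite power_sum_monom ?ltn_ord // rmorph1 mul1r.
Qed.

Lemma tensor_radical_ext : radical_ext p q inl (inr t).
Proof.
split; [|exact: tensor_span | exact: tensor_free].
by rewrite -rmorphXn (rx_root g_ext) rmorph_nat.
Qed.

End TensorRadical.

(** * Nilpotents in [R[t]/(t^q - p)] *)

(** The fields [pr_mod_p] and [pr_mod_torsion] say that [R/p] and
    [R/(R[p] + pR)] are reduced; multiplying by [p] in the latter avoids
    quotients by the torsion [R[p]]. *)
Record p_reduced (p : nat) (R : comPzRingType) : Prop := PReduced {
  pr_torsion : forall r : R, p%:R * (p%:R * r) = 0 -> p%:R * r = 0;
  pr_mod_p : forall r : R, pdvd p 1 (r ^+ p) -> pdvd p 1 r;
  pr_mod_torsion : forall r : R, pdvd p 2 (p%:R * r ^+ p) -> pdvd p 2 (p%:R * r);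
  pr_separated : p_separated p R;
  pr_complete : p_complete p R }.

Lemma torsion_powers (p : nat) (R : comPzRingType) n (r : R) :
  p_reduced p R -> (p ^ n)%:R * r = 0 -> p%:R * r = 0.
Proof.
move=> R_red; elim: n r => [|n IH] r; first by rewrite mul1r => ->; rewrite mulr0.
by rewrite expnSr natrM -mulrA => /IH /(pr_torsion R_red).
Qed.

Section RadicalArithmetic.
Variables (p q : nat) (p_pr : prime p) (q_gt0 : (0 < q)%N).
Variables (R B : comPzRingType) (f : {rmorphism R -> B}) (t : B).
Hypotheses (R_red : p_reduced p R) (f_ext : radical_ext p q f t).
Local Notation ps := (power_sum f t q).

Lemma radical_pdvd n c : pdvd p n (ps c) <-> forall j, (j < q)%N -> pdvd p n (c j).
Proof.
split=> [[y cy] j jq|cn].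
  have [d dE] := rx_span f_ext y; exists (d j).
  by apply: (radical_ext_inj f_ext (d := fun j => (p ^ n)%:R * d j)); rewrite ?power_sumMn -?dE.
have /choice [d dE] j : exists y, (j < q)%N -> c j = (p ^ n)%:R * y.
  by have [/cn [y ->]|_] := ltnP j q; [exists y | exists 0].
by exists (ps d); rewrite -power_sumMn; apply: eq_power_sum.
Qed.

Lemma radical_separated : p_separated p B.
Proof.
move=> z; have [c ->] := rx_span f_ext z => cn.
rewrite -(power_sum0 f t q); apply: eq_power_sum => j jq.
by apply: (pr_separated R_red) => n; apply: (radical_pdvd n c).1.
Qed.

Lemma radical_complete : p_complete p B.
Proof.
move=> w; have /choice [c cE] l := rx_span f_ext (w l).
have /choice [s sE] j := pr_complete R_red (c^~ j).
exists (ps s) => n.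
have -> : psum p w n = ps (fun j => psum p (c^~ j) n).
  rewrite /psum; under eq_bigr => l _ do rewrite cE -power_sumMn.
  elim: n => [|n IH]; first by rewrite big_ord0 -(power_sum0 f t q);
    apply: eq_power_sum => j _; rewrite big_ord0.
  rewrite big_ord_recr /= IH -power_sumD; apply: eq_power_sum => j _.
  by rewrite big_ord_recr.
by rewrite -power_sumB; apply/radical_pdvd.
Qed.

Lemma radical_torsion (z : B) : p%:R * (p%:R * z) = 0 -> p%:R * z = 0.
Proof.
have [c ->] := rx_span f_ext z; rewrite -!power_sumMn => c0.
rewrite -(power_sum0 f t q); apply: eq_power_sum => j jq.
apply: (pr_torsion R_red); exact: (rx_free f_ext c0).
Qed.

Lemma radical_torsion_root m (z : B) : p%:R * (t ^+ m * z) = 0 -> p%:R * z = 0.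
Proof.
elim: m => [|m IH]; first by rewrite mul1r.
rewrite exprS -mulrA => tz; apply: IH; apply: radical_torsion.
by rewrite -{1}(rx_root f_ext) -(prednK q_gt0) exprSr -mulrA [t * _]mulrCA tz mulr0.
Qed.

Lemma power_sum_head c :
  ps c = f (c 0%N) + t * ps (fun j => if (j.+1 < q)%N then c j.+1 else 0).
Proof.
rewrite /power_sum mulr_sumr; case: q q_gt0 => // q' _; rewrite big_ord_recl /= mulr1.
congr (_ + _); rewrite [RHS]big_ord_recr /= ltnn rmorph0 mul0r mulr0 addr0.
apply: eq_bigr => j _; rewrite /bump /= add1n exprS mulrCA; do 2!congr (_ * _).
by rewrite ltnS ltn_ord.
Qed.

Lemma root_mul_power_sum c :
  t * ps c = ps (fun j => if j is j'.+1 then c j' else p%:R * c q.-1).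
Proof.
have tq := rx_root f_ext; rewrite /power_sum mulr_sumr.
case: q q_gt0 tq => // q' _ tq; rewrite [RHS]big_ord_recl [LHS]big_ord_recr /= addrC.
congr (_ + _); first by rewrite mulrCA -exprS tq rmorphM rmorph_nat mulr1 mulrC.
by apply: eq_bigr => j _; rewrite /bump /= add1n exprS mulrCA.
Qed.

Lemma radical_inj (r : R) : f r = 0 -> r = 0.
Proof.
move=> fr; apply: (rx_free f_ext (c := fun j => if j == 0%N then r else 0) _ q_gt0).
by rewrite power_sum_monom // fr mul0r.
Qed.

Lemma torsion_congrX n (x y : B) : p%:R * x = p%:R * y -> p%:R * x ^+ n = p%:R * y ^+ n.
Proof.
move=> xy; elim: n => [//|n IH].
by rewrite !exprS mulrA xy -mulrA mulrCA IH mulrCA.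
Qed.

(** [B/B[p]] has the nonzerodivisor [t] and the reduced quotient
    [R/(R[p] + pR)] by it, so a power torsion element can be divided by [t]
    again and again; iterating, [z] lies in [B[p] + t^m B] for every [m]. *)
Lemma torsion_root_approx m (z : B) : p%:R * z ^+ p = 0 ->
  exists u w, p%:R * u = 0 /\ z = u + t ^+ m * w.
Proof.
elim: m z => [|m IH] z zp; first by exists 0, z; rewrite mulr0 add0r mul1r.
have [c zE] := rx_span f_ext z.
pose z1 := ps (fun j => if (j.+1 < q)%N then c j.+1 else 0).
have {}zE : z = f (c 0%N) + t * z1 by rewrite zE power_sum_head.
have [y yE] : exists y, z ^+ p = f (c 0%N ^+ p) + t * y.
  rewrite zE; elim: (p) => [|n [y yE]]; first by exists 0; rewrite !expr0 rmorph1 mulr0 addr0.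
  exists (z1 * (f (c 0%N ^+ n) + t * y) + f (c 0%N) * y).
  by rewrite !exprS yE rmorphM; ring.
have [d dE] := rx_span f_ext y.
(* the coefficient of t^0 in p z^p, where t^q = p contributes p d_(q-1) *)
have c0p : p%:R * (c 0%N ^+ p + p%:R * d q.-1) = 0.
  pose e j := if j is j'.+1 then d j' else c 0%N ^+ p + p%:R * d q.-1.
  have := rx_free f_ext (c := fun j => p%:R * e j) _ q_gt0; apply.
  rewrite power_sumMn -zp; congr (_ * _); rewrite yE dE root_mul_power_sum.
  rewrite -[f _]mulr1 -[X in _ * X](expr0 t) -(power_sum_monom f t (c 0%N ^+ p) q_gt0).
  by rewrite -power_sumD; apply: eq_power_sum => -[|j] _ //=; rewrite add0r.
have [|s ps0] := pr_mod_torsion R_red (r := c 0%N).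
  exists (- d q.-1); apply/eqP; rewrite -subr_eq0 -c0p expnS expn1 natrM; apply/eqP; ring.
pose u := c 0%N - p%:R * s.
have u0 : p%:R * f u = 0.
  by rewrite -(rmorph_nat f) -rmorphM /u mulrBr ps0 expnS expn1 natrM mulrA subrr rmorph0.
pose z' := t ^+ q.-1 * f s + z1.
have zE' : z = f u + t * z'.
  rewrite zE /u rmorphB rmorphM rmorph_nat -(rx_root f_ext) -(prednK q_gt0) exprS /z'; ring.
have zp' : p%:R * z' ^+ p = 0.
  apply: (radical_torsion_root (m := p)); rewrite -exprMn -zp; apply: torsion_congrX.
  by rewrite zE' [RHS]mulrDr u0 add0r.
have [u' [w [u'0 z'E]]] := IH _ zp'.
exists (f u + t * u'), w; split; first by rewrite mulrDr u0 mulrCA u'0 mulr0 addr0.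
by rewrite zE' z'E exprS; ring.
Qed.

Lemma torsion_of_expp (z : B) : p%:R * z ^+ p = 0 -> p%:R * z = 0.
Proof.
move=> zp; apply: radical_separated => n.
have [u [w [u0 ->]]] := torsion_root_approx (q * n) zp.
rewrite mulrDr u0 add0r exprM (rx_root f_ext) -natrX mulrCA; exact: pdvd_mulp.
Qed.

Lemma nilpotent_torsion (z : B) : nilradical B z -> p%:R * z = 0.
Proof.
case=> N zN; have {zN} : p%:R * z ^+ (p ^ N) = 0.
  have /subnK <- : (N <= p ^ N)%N by exact/ltnW/ltn_expl/prime_gt1.
  by rewrite exprD zN !mulr0.
elim: N => [|N IH]; first by rewrite expr1.
by rewrite expnSr exprM => /torsion_of_expp.
Qed.

Lemma base_reduced (r : R) N : r ^+ N = 0 -> r = 0.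
Proof.
move=> rN; have pr : p%:R * r = 0.
  apply: radical_inj; rewrite rmorphM rmorph_nat; apply: nilpotent_torsion.
  by exists N; rewrite -rmorphXn rN rmorph0.
have {rN} : pdvd p 1 (r ^+ (p ^ N)).
  have /subnK <- : (N <= p ^ N)%N by exact/ltnW/ltn_expl/prime_gt1.
  by rewrite exprD rN mulr0; apply: pdvd0.
elim: N => [|N IH]; last by rewrite expnSr exprM => /(pr_mod_p R_red).
by rewrite expr1 => /pdvd1 [s rs]; move: pr; rewrite rs => /(pr_torsion R_red).
Qed.

(** If [z] is nilpotent then [p z = 0]; what is left of [z] besides its
    coefficient [c 0] is then nilpotent too, since its [q]-th power is a
    multiple of [p z1 = 0], and [R] is reduced. *)
Lemma nilradicalP c :
  nilradical B (ps c) <-> c 0%N = 0 /\ forall j, (j < q)%N -> p%:R * c j = 0.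
Proof.
rewrite power_sum_head; set z1 := ps _.
have nil1 : p%:R * z1 = 0 -> nilradical B (t * z1).
  move=> z10; exists q; rewrite exprMn (rx_root f_ext) -(prednK q_gt0) exprS mulrA.
  by rewrite z10 mul0r.
split=> [nz|[c0 cp]].
  have cp j : (j < q)%N -> p%:R * c j = 0.
    apply: (rx_free f_ext (c := fun j => p%:R * c j)).
    by rewrite power_sumMn power_sum_head nilpotent_torsion.
  have z10 : p%:R * z1 = 0.
    rewrite -power_sumMn -(power_sum0 f t q); apply: eq_power_sum => j jq.
    by case: ifP => [/cp|_]; rewrite ?mulr0.
  split=> //; have [N] := idealB nz (nil1 z10).
  by rewrite addrK -rmorphXn => /radical_inj/base_reduced.
rewrite c0 rmorph0 add0r; apply: nil1; rewrite -power_sumMn -(power_sum0 f t q).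
by apply: eq_power_sum => j jq; case: ifP => [/cp|_]; rewrite ?mulr0.
Qed.

End RadicalArithmetic.

(** * Principal ideals *)

Section PrincipalIdeals.
Variable A : comPzRingType.
Implicit Types (a x : A).

Lemma principalP a x : principal a x <-> exists y, x = y * a.
Proof.
split=> [|[y ->]]; last by apply/idealM/gen_idealP.
have K0 : exists y, (0 : A) = y * a by exists 0; rewrite mul0r.
have KD u v : (exists y, u = y * a) -> (exists y, v = y * a) -> exists y, u + v = y * a.
  by move=> [y ->] [y' ->]; exists (y + y'); rewrite mulrDl.
have KM b u : (exists y, u = y * a) -> exists y, b * u = y * a.
  by move=> [y ->]; exists (b * y); rewrite mulrA.
by move/(_ (Ideal K0 KD KM)); apply => _ -> /=; exists 1; rewrite mul1r.
Qed.

End PrincipalIdeals.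

Section ExtendedIdeals.
Variable A : comPzRingType.
Implicit Types (a x : A).

Lemma ext_principalP (B : comPzRingType) (g : {rmorphism B -> A}) (b : B) x :
  ext_ideal g (principal b) x <-> exists y, x = y * g b.
Proof.
split=> [|[y ->]].
  move/(_ (principal (g b))); rewrite principalP; apply => _ [c bc ->].
  have [y ->] := (principalP b c).1 bc.
  by apply/principalP; exists (g y); rewrite rmorphM.
by apply/idealM/gen_idealP; exists b => //; apply: gen_idealP.
Qed.

Lemma principal_expP a n x : ideal_exp (principal a) n x <-> exists y, x = y * a ^+ n.
Proof.
elim: n x => [|n IH] x /=.
  by split=> [_|_]; [exists x; rewrite mulr1 | apply: gen_idealP].
split=> [|[y ->]].
  rewrite exprS; move/(_ (principal (a * a ^+ n))); rewrite principalP; apply.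
  move=> _ [b [c [/principalP[y ->] /IH[z ->] ->]]].
  by apply/principalP; exists (y * z); rewrite mulrACA.
apply: gen_idealP; exists a, (y * a ^+ n); split; first exact: gen_idealP.
  by apply/IH; exists y.
by rewrite exprS mulrCA.
Qed.

Lemma in_jacobson_of_units x : (forall a, exists b, (1 - a * x) * b = 1) -> in_jacobson x.
Proof.
move=> xP I [I1 I_max]; apply: contrapT => Ix.
pose J z := exists a b, I a /\ z = a + b * x.
have J0 : J 0 by exists 0, 0; split; [apply: ideal0 | rewrite mul0r addr0].
have JD u v : J u -> J v -> J (u + v).
  move=> [a [b [Ia ->]]] [c [d [Ic ->]]]; exists (a + c), (b + d); split.
    exact: idealD.
  by rewrite mulrDl addrACA.
have JM c u : J u -> J (c * u).
  move=> [a [b [Ia ->]]]; exists (c * a), (c * b); split; first exact: idealM.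
  by rewrite mulrDr mulrA.
have [J1|J1] := pselect (J 1).
  have [a [b [Ia E]]] := J1; have [c bc] := xP b.
  by apply: I1; rewrite -bc mulrC; apply: idealM; rewrite E addrK.
apply: Ix; apply/(I_max (Ideal J0 JD JM)) => //= [z Iz|].
  by exists z, 0; rewrite mul0r addr0.
by exists 0, 1; split; [apply: ideal0 | rewrite mul1r add0r].
Qed.

End ExtendedIdeals.

(** * Frobenius projections *)

Section CharP.
Variables (p : nat) (p_pr : prime p) (A : comPzRingType) (p0 : (p%:R : A) = 0).

Lemma exprpD (x y : A) : (x + y) ^+ p = x ^+ p + y ^+ p.
Proof.
rewrite exprDn; have [p' pE] : exists p', p = p'.+1.
  by exists p.-1; rewrite prednK // prime_gt0.
rewrite pE big_ord_recl big_ord_recr /= -pE subn0 expr0 mulr1 bin0.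
rewrite /bump /= !add1n -pE subnn expr0 mul1r binn big1 ?add0r // => i _.
have /dvdnP [c cE] : (p %| 'C(p, i.+1))%N.
  by apply: prime_dvd_bin => //=; rewrite pE ltnS ltn_ord.
by rewrite /bump /= add1n cE mulrnA -mulr_natr p0 mulr0.
Qed.

Lemma exprpB (x y : A) : (x - y) ^+ p = x ^+ p - y ^+ p.
Proof. by apply: (addIr (y ^+ p)); rewrite -exprpD !subrK. Qed.

Lemma exprp_sum (I : finType) (F : I -> A) : (\sum_i F i) ^+ p = \sum_i F i ^+ p.
Proof.
apply: (big_morph (fun x => x ^+ p) exprpD).
by rewrite expr0n gtn_eqF ?prime_gt0.
Qed.

End CharP.

Section FrobeniusProjection.
Variables (p : nat) (p_pr : prime p) (R : comPzRingType) (I0 : ideal R).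
Variables (T : tower) (e : {rmorphism R -> T 0%N}).
Hypothesis T_pit : purely_inseparable_tower p I0 e.

Lemma tower_bar_p0 i : (p%:R : tower_bar I0 e i) = 0.
Proof.
rewrite -(rmorph_nat (quot_pi (base_ideal I0 e i))) -(rmorph0 (quot_pi (base_ideal I0 e i))).
apply/quot_pi_eq; rewrite subr0; apply: gen_idealP; exists p%:R; first exact: pit_p T_pit.
by rewrite rmorph_nat.
Qed.

Definition frob_proj_fun & purely_inseparable_tower p I0 e :=
  fun i (x : tower_bar I0 e i.+1) => sval (cid (pit_frob T_pit x)).
Local Notation F := (frob_proj_fun T_pit).

Lemma frob_projP i x : tbar I0 e i (F x) = x ^+ p.
Proof. by rewrite /frob_proj_fun; case: cid. Qed.

Lemma frob_proj_zmod i : zmod_morphism (@frob_proj_fun T_pit i).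
Proof.
move=> x y; apply: (pit_inj T_pit); rewrite rmorphB !frob_projP.
exact/exprpB/tower_bar_p0.
Qed.
Lemma frob_proj_monoid i : monoid_morphism (@frob_proj_fun T_pit i).
Proof.
split=> [|x y]; apply: (pit_inj T_pit).
  by rewrite rmorph1 frob_projP expr1n.
by rewrite rmorphM !frob_projP exprMn.
Qed.
HB.instance Definition _ i := GRing.isZmodMorphism.Build _ _
  (@frob_proj_fun T_pit i) (frob_proj_zmod (i := i)).
HB.instance Definition _ i := GRing.isMonoidMorphism.Build _ _
  (@frob_proj_fun T_pit i) (frob_proj_monoid i).

Definition frob_proj i : {rmorphism tower_bar I0 e i.+1 -> tower_bar I0 e i} :=
  @frob_proj_fun T_pit i.

Lemma frob_projE i x : tbar I0 e i (frob_proj i x) = x ^+ p.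
Proof. exact: frob_projP. Qed.

End FrobeniusProjection.

(** * Towers of radical extensions *)

Section RadicalTower.
Variables (p : nat) (p_pr : prime p) (R : comPzRingType) (phi : {rmorphism R -> R}).
Hypothesis R_red : p_reduced p R.
Hypothesis phiP : forall r, exists s, phi r = r ^+ p + p%:R * s.
Variables (B : nat -> comPzRingType) (f : forall i, {rmorphism R -> B i}).
Variables (t : forall i, B i) (next : forall i, {rmorphism B i -> B i.+1}).
Hypothesis f_ext : forall i, radical_ext p (p ^ i) (f i) (t i).
Hypothesis next_base : forall i r, next i (f i r) = f i.+1 (phi r).
Hypothesis next_root : forall i, next i (t i) = t i.+1 ^+ p.

Definition radical_tower : tower := {|
  tower_ring i := quot (nilradical (B i));
  tower_map i := quot_map (@nilradical_map _ _ (next i)) |}.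

Definition radical_tower_base : {rmorphism R -> radical_tower 0%N} :=
  quot_pi (nilradical (B 0%N)) \o f 0%N.

Local Notation T := radical_tower.
Local Notation e := radical_tower_base.
Local Notation I0 := (principal (p%:R : R)).
Local Notation cls i := (quot_pi (nilradical (B i)) : {rmorphism B i -> T i}).
Local Notation bar i := (quot_pi (base_ideal I0 e i) : {rmorphism T i -> tower_bar I0 e i}).
Local Notation ps i := (power_sum (f i) (t i)).

Let q_gt0 i : (0 < p ^ i)%N.
Proof. by rewrite expn_gt0 prime_gt0. Qed.

Lemma base_idealP i x : base_ideal I0 e i x <-> exists y, x = p%:R * y.
Proof.
rewrite /base_ideal ext_principalP rmorph_nat.
by split=> -[y ->]; exists y; rewrite mulrC.
Qed.

Lemma cls_surj i (x : T i) : exists c, x = cls i (ps i (p ^ i) c).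
Proof.
elim/quot_piW: x => z; have [c zE] := rx_span (f_ext i) z.
by exists c; rewrite -zE.
Qed.

Lemma bar_surj i (x : tower_bar I0 e i) : exists c, x = bar i (cls i (ps i (p ^ i) c)).
Proof.
by elim/quot_piW: x => x; have [c ->] := cls_surj x; exists c.
Qed.

Lemma cls_eq0 i z : cls i z = 0 <-> nilradical (B i) z.
Proof. by rewrite -(rmorph0 (cls i)) quot_pi_eq subr0. Qed.

(** In degree [j > 0] the ring [T i] is [R/R[p]], whence the condition
    [c j \in R[p] + pR], multiplied by [p]. *)
Lemma bar_eq0 i c : bar i (cls i (ps i (p ^ i) c)) = 0 <->
  pdvd p 1 (c 0%N) /\ forall j, (j < p ^ i)%N -> pdvd p 2 (p%:R * c j).
Proof.
have nilP := nilradicalP p_pr (q_gt0 i) R_red (f_ext i).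
rewrite -(rmorph0 (bar i)) quot_pi_eq subr0 base_idealP; split=> [[y]|[c0 cp]].
  have [d ->] := cls_surj y; rewrite -(rmorph_nat (cls i)) -rmorphM => /eqP.
  rewrite -subr_eq0 -rmorphB => /eqP/cls_eq0; rewrite -power_sumMn -power_sumB => /nilP.
  case=> d0 dp; split.
    by apply/pdvd1; exists (d 0%N); apply/eqP; rewrite -subr_eq0 d0.
  move=> j jq; exists (d j); apply/eqP; rewrite -subr_eq0 expnS expn1 natrM -mulrA -mulrBr.
  by rewrite dp.
(* in degree 0 the equation must hold before multiplication by p *)
have /choice [d dE] j : exists y, (j < p ^ i)%N ->
    p%:R * c j = p%:R * (p%:R * y) /\ (j = 0%N -> c j = p%:R * y).
  case: j => [|j]; first by have /pdvd1 [y ->] := c0; exists y.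
  have [/cp [y yE]|_] := ltnP j.+1 (p ^ i); last by exists 0.
  by exists y => _; split=> //; rewrite yE expnS expn1 natrM mulrA.
exists (cls i (ps i (p ^ i) d)); apply/eqP; rewrite -subr_eq0; apply/eqP.
rewrite -(rmorph_nat (cls i)) -rmorphM -rmorphB -power_sumMn -power_sumB.
apply/cls_eq0/nilP; split=> [|j jq]; first by rewrite (dE _ (q_gt0 i)).2 // subrr.
by rewrite mulrBr (dE j jq).1 subrr.
Qed.

Lemma tbar_bar i z : tbar I0 e i (bar i (cls i z)) = bar i.+1 (cls i.+1 (next i z)).
Proof. by rewrite /tbar !quot_mapE. Qed.

Lemma phi_pdvd r : pdvd p 1 (phi r) -> pdvd p 1 r.
Proof.
have [s ->] := phiP r => rs; apply: (pr_mod_p R_red).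
by rewrite -[_ ^+ p](addrK (p%:R * s)); apply: pdvdB => //; apply/pdvd1; exists s.
Qed.

Lemma phi_pdvd_torsion r : pdvd p 2 (p%:R * phi r) -> pdvd p 2 (p%:R * r).
Proof.
have [s ->] := phiP r => rs; apply: (pr_mod_torsion R_red).
rewrite -[_ * _ ^+ p](addrK (p%:R * (p%:R * s))) -mulrDr; apply: pdvdB => //.
by exists s; rewrite expnS expn1 natrM mulrA.
Qed.

Lemma next_power_sum i c : next i (ps i (p ^ i) c) =
  ps i.+1 (p ^ i.+1) (fun l => if (p %| l)%N then phi (c (l %/ p)%N) else 0).
Proof.
rewrite {1}/power_sum rmorph_sum.
have lt_pj (j : 'I_(p ^ i)) : (p * j < p ^ i.+1)%N by rewrite expnS ltn_pmul2l ?prime_gt0.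
under eq_bigr => j _ do
  rewrite rmorphM rmorphXn next_base next_root -exprM -(power_sum_monom _ _ _ (lt_pj j)).
rewrite exchange_big; apply: eq_bigr => l _; rewrite -mulr_suml -rmorph_sum; congr (f _ _ * _).
case: ifP => [/dvdnP [d ld]|pl].
  have dq : (d < p ^ i)%N.
    by rewrite -(ltn_pmul2r (prime_gt0 p_pr)) -ld -expnSr ltn_ord.
  rewrite (bigD1 (Ordinal dq)) //= ld mulnC eqxx mulKn ?prime_gt0 // big1 ?addr0 // => j.
  rewrite -val_eqE /= eqn_pmul2l ?prime_gt0 // eq_sym => /negPf -> //.
by rewrite big1 // => j _; case: eqP pl => // ->; rewrite dvdn_mulr.
Qed.

(** The transition map spreads the coefficients out without mixing them, so
    injectivity follows from that of the Frobenius on [R/p] and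
    [R/(R[p] + pR)]. *)
Lemma radical_tower_inj i : injective (tbar I0 e i).
Proof.
move=> x y; move/eqP; rewrite -subr_eq0 -rmorphB => /eqP xy.
apply/eqP; rewrite -subr_eq0; apply/eqP; move: xy.
have [c ->] := bar_surj (x - y); rewrite tbar_bar next_power_sum => /bar_eq0 [c0 cp].
apply/bar_eq0; split=> [|j jq].
  by apply: phi_pdvd; move: c0; rewrite dvdn0 div0n.
apply: phi_pdvd_torsion; have := cp (j * p)%N.
by rewrite dvdn_mull // mulnK ?prime_gt0 // expnSr ltn_pmul2r ?prime_gt0 //; apply.
Qed.

Lemma bar_p0 i : (p%:R : tower_bar I0 e i) = 0.
Proof.
by rewrite -(rmorph_nat (bar i)) -(rmorph0 (bar i)); apply/quot_pi_eq/base_idealP;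
  exists 1; rewrite subr0 mulr1.
Qed.

(** Modulo [p] the transition map is the Frobenius in disguise: it raises both
    the elements of [R] and the root of [p] to the power [p]. *)
Lemma tbar_power_sum i n c :
  tbar I0 e i (bar i (cls i (ps i n c))) = bar i.+1 (cls i.+1 (ps i.+1 n c)) ^+ p.
Proof.
rewrite tbar_bar /power_sum !rmorph_sum (exprp_sum p_pr (bar_p0 _)).
apply: eq_bigr => j _; rewrite !rmorphM !rmorphXn exprMn next_root next_base.
congr (_ * _); last by rewrite !rmorphXn -!exprM mulnC.
have [s ->] := phiP (c j).
by rewrite !rmorphD !rmorphM !rmorph_nat bar_p0 mul0r addr0 !rmorphXn.
Qed.

Lemma cls_base_inj i r r' : cls i (f i r) = cls i (f i r') -> r = r'.
Proof.
move=> rr; apply/eqP; rewrite -subr_eq0; apply/eqP.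
have [|n] := (cls_eq0 (f i (r - r'))).1; first by rewrite !rmorphB rr subrr.
rewrite -rmorphXn => /(radical_inj (q_gt0 i) (f_ext i)).
exact: (base_reduced p_pr (q_gt0 i) R_red (f_ext i)).
Qed.

Lemma radical_tower_pit : purely_inseparable_tower p I0 e.
Proof.
split.
- have e_surj x : exists r, x = e r.
    have [c ->] := cls_surj x; exists (c 0%N).
    by rewrite /power_sum big_ord1 /= mulr1.
  have [g gE] := choice e_surj; exists g => [r|x]; last by rewrite -gE.
  exact/(@cls_base_inj 0)/esym/gE.
- exact: gen_idealP.
- exact: radical_tower_inj.
- move=> i x; have [c ->] := bar_surj x.
  by exists (bar i (cls i (ps i (p ^ i.+1) c))); rewrite tbar_power_sum.
Qed.

Local Notation F := (frob_proj p_pr radical_tower_pit).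

Lemma frob_proj_power_sum i n c :
  F i (bar i.+1 (cls i.+1 (ps i.+1 n c))) = bar i (cls i (ps i n c)).
Proof.
by apply: (pit_inj radical_tower_pit); rewrite frob_projE tbar_power_sum.
Qed.

Lemma from_oneE i : from_one T i (cls 1 (t 1%N)) = cls i.+1 (t i.+1 ^+ (p ^ i)).
Proof.
elim: i => [|i IH]; first by rewrite expr1.
by rewrite [LHS]/= IH quot_mapE rmorphXn next_root -exprM -expnS.
Qed.

Lemma bar_root i : bar i (cls i (t i ^+ (p ^ i))) = 0.
Proof. by rewrite (rx_root (f_ext i)) !rmorph_nat bar_p0. Qed.

(** The terms of degree at least [p^i] are multiples of [t^(p^i)], which [F i]
    sends to [p = 0]; on the terms of smaller degree the vanishing criteria at
    the levels [i] and [i.+1] agree. *)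
Lemma frob_proj_kernel i x : F i x = 0 <->
  ext_ideal (fun y => bar i.+1 (from_one T i y)) (principal (cls 1 (t 1%N))) x.
Proof.
rewrite (ext_principalP (bar i.+1 \o from_one T i : {rmorphism T 1%N -> _})) /= from_oneE.
split=> [|[y ->]].
  have [c ->] := bar_surj x; rewrite frob_proj_power_sum.
  have qq : (p ^ i <= p ^ i.+1)%N by rewrite leq_exp2l ?prime_gt1.
  have splitE j : bar j (cls j (ps j (p ^ i.+1) c)) = bar j (cls j (ps j (p ^ i) c)) +
      bar j (cls j (t j ^+ (p ^ i))) *
      bar j (cls j (ps j (p ^ i.+1 - p ^ i) (fun l => c (p ^ i + l)%N))).
    by rewrite -{1}(subnKC qq) power_sum_cat !rmorphD !rmorphM.
  rewrite !splitE bar_root mul0r addr0 => /bar_eq0 [c0 cp].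
  eexists; rewrite mulrC (power_sum_widen _ _ _ qq) [X in X + _](_ : _ = 0) ?add0r //.
  apply/bar_eq0; rewrite q_gt0; split=> // j _.
  by case: ifP => [/cp //|_]; rewrite mulr0; apply: pdvd0.
rewrite rmorphM [X in _ * X](_ : _ = 0) ?mulr0 //.
have tE j n : cls j (t j ^+ n) = cls j (ps j n.+1 (fun l => if l == n then 1 else 0)).
  by rewrite power_sum_monom // rmorph1 mul1r.
by rewrite tE frob_proj_power_sum -tE bar_root.
Qed.

Lemma torsionP i (x : T i) : torsion I0 e x <->
  exists r, p%:R * r = 0 /\ x = cls i (f i r).
Proof.
have nilP := nilradicalP p_pr (q_gt0 i) R_red (f_ext i).
split=> [[n xn]|[r [pr ->]]]; last first.
  exists 1%N => a /principal_expP [y ->]; rewrite expr1 rmorphM rmorph_nat -mulrA.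
  by rewrite -(rmorph_nat (cls i)) -rmorphM -(rmorph_nat (f i)) -rmorphM pr !rmorph0 mulr0.
have := xn (p%:R ^+ n); have [c ->] := cls_surj x; move=> {}xn.
have {xn} : cls i (ps i (p ^ i) (fun j => (p ^ n)%:R * c j)) = 0.
  rewrite power_sumMn rmorphM rmorph_nat natrX -(rmorph_nat (from_base e i)) -rmorphXn.
  by apply: xn; apply/principal_expP; exists 1; rewrite mul1r.
case/cls_eq0/nilP => c0 cn.
have cp j : (j < p ^ i)%N -> p%:R * c j = 0.
  by move=> jq; apply: (torsion_powers (n := n.+1) R_red); rewrite expnS natrM -mulrA cn.
exists (c 0%N); split; first exact: cp.
apply/eqP; rewrite -subr_eq0; apply/eqP; rewrite -rmorphB.
have -> : f i (c 0%N) = ps i (p ^ i) (fun j => if j == 0%N then c 0%N else 0).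
  by rewrite power_sum_monom // mulr1.
rewrite -power_sumB; apply/cls_eq0/nilP; split=> [|j jq]; first by rewrite eqxx subrr.
by case: eqP => [->|_]; rewrite ?subrr ?mulr0 // subr0 cp.
Qed.

Lemma bar_base_inj i (r r' : R) : p%:R * r = 0 -> p%:R * r' = 0 ->
  bar i (cls i (f i r)) = bar i (cls i (f i r')) -> r = r'.
Proof.
move=> pr pr' /eqP; rewrite -subr_eq0 -!rmorphB => /eqP.
rewrite -[f i _]mulr1 -(expr0 (t i)) -(power_sum_monom _ _ _ (q_gt0 i)) => /bar_eq0 [].
move=> /pdvd1 [s rs] _; apply/eqP; rewrite -subr_eq0; apply/eqP.
by move: rs => /= rs; rewrite rs; apply: (pr_torsion R_red); rewrite -rs mulrBr pr pr' subrr.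
Qed.

Lemma frob_proj_base i r : F i (bar i.+1 (cls i.+1 (f i.+1 r))) = bar i (cls i (f i r)).
Proof.
have fE j : f j r = ps j 1 (fun=> r) by rewrite /power_sum big_ord1 mulr1.
by rewrite !fE frob_proj_power_sum.
Qed.

(** The torsion of every ring of the tower is the [p]-torsion of [R], and the
    Frobenius projections fix the image of [R]. *)
Lemma frob_proj_torsion i :
  exists! G : torsion_type I0 e i.+1 -> torsion_type I0 e i, bijective G /\
    forall x, F i (bar i.+1 (sval x)) = bar i (sval (G x)).
Proof.
have tor j r : p%:R * r = 0 -> torsion I0 e (cls j (f j r)) by move=> pr; apply/torsionP; exists r.
have rE j (x : torsion_type I0 e j) := (torsionP (sval x)).1 (svalP x).
(* r j x is the element of R[p] whose image is x *)
pose r j x := sval (cid (rE j x)).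
have rP j x : p%:R * r j x = 0 /\ sval x = cls j (f j (r j x)) by rewrite /r; case: cid.
pose G j l (x : torsion_type I0 e j) : torsion_type I0 e l :=
  exist _ _ (tor l (r j x) (rP j x).1).
have rG j l x : r l (G j l x) = r j x.
  by apply: (@cls_base_inj l); rewrite -(rP l _).2.
have GK j l : cancel (G j l) (G l j).
  move=> x; apply/eq_sig_hprop => [*|]; first exact: Prop_irrelevance.
  by rewrite /= rG -(rP j x).2.
have GF x : F i (bar i.+1 (sval x)) = bar i (sval (G i.+1 i x)).
  by rewrite {1}(rP _ x).2 frob_proj_base.
exists (G i.+1 i); split=> [|G' [_ G'F]]; first by split=> //; exists (G i i.+1).
apply/funext => x; apply/eq_sig_hprop => [*|]; first exact: Prop_irrelevance.
rewrite [RHS](rP i _).2 /=; congr (cls i (f i _)).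
apply: (@bar_base_inj i); [exact: (rP _ x).1 | exact: (rP i _).1 |].
by rewrite -(rP i (G' x)).2 -G'F GF.
Qed.

Lemma radical_tower_perfectoid : perfectoid_tower p I0 e.
Proof.
split; first exact: radical_tower_pit.
exists (fun i => F i); split.
- move=> i x; exact: frob_projE.
- move=> i y; have [c ->] := bar_surj y.
  by exists (bar i.+1 (cls i.+1 (ps i.+1 (p ^ i) c))); rewrite frob_proj_power_sum.
- move=> i x /base_idealP [y ->]; apply: in_jacobson_of_units => a.
  rewrite mulrCA; elim/quot_piW: (a * y) => z.
  have [w zw] := p_complete_inv z (radical_separated R_red (f_ext i))
    (radical_complete R_red (f_ext i)).
  exists (cls i w); have := congr1 (cls i) zw.
  by rewrite rmorph1 rmorphM rmorphB rmorph1 rmorphM rmorph_nat.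
- by exists p%:R.
- exists (cls 1 (t 1%N)); split=> [x|i x]; last exact: frob_proj_kernel.
  rewrite principal_expP base_idealP -rmorphXn (rx_root (f_ext 1)) rmorph_nat.
  by split=> -[y ->]; exists y; rewrite mulrC.
- move=> i; split; last exact: frob_proj_torsion.
  move=> a x /principalP [y ->] /torsionP [r [pr ->]].
  rewrite rmorphM rmorph_nat -mulrA -(rmorph_nat (cls i)) -rmorphM.
  by rewrite -(rmorph_nat (f i)) -rmorphM pr !rmorph0 mulr0.
Qed.

End RadicalTower.

(** * Squarefree monomial ideals *)

Section PowerSeriesCoefficients.
Import mpoly.
Variables (m : nat) (B : comNzRingType).
Implicit Types (a : mpseries m B) (u E : 'X_{1..m}).

Lemma mpscoefE (c : 'X_{1..m} -> B) u : mpscoef (MPSeries c) u = c u.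
Proof. by []. Qed.

Definition mps_monom E : mpseries m B := MPSeries (fun u => (u == E)%:R).

Lemma mpscoef_monomM E a u :
  mpscoef (mps_monom E * a) u = if (E <= u)%MM then mpscoef a (u - E)%MM else 0.
Proof.
rewrite mpscoefM; case: ifPn => [leEu|nEu]; last first.
  rewrite big1 // => k /eqP uE /=; case: eqP => [kE|_]; last by rewrite mul0r.
  by case/negP: nEu; rewrite uE kE lem_addr.
have EN : (mdeg E < (mdeg u).+1)%N by rewrite ltnS -(submK leEu) mdegD leq_addl.
have uN : (mdeg (u - E)%MM < (mdeg u).+1)%N by rewrite ltnS mdegB.
rewrite (bigD1 (BMultinom EN, BMultinom uN)) /=; last by rewrite addmC submK.
rewrite eqxx mul1r big1 ?addr0 // => k /andP [/eqP uE kne].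
case: eqP => [kE|_]; last by rewrite mul0r.
case/eqP: kne; case: k uE kE => k1 k2 /= uE kE; congr (_, _); apply: val_inj => //=.
by rewrite -[LHS](addmK E) addmC -kE -uE.
Qed.

Lemma mps_monomD E E' : mps_monom (E + E')%MM = mps_monom E * mps_monom E'.
Proof.
apply: mpseriesP => u; rewrite mpscoef_monomM /=; case: ifPn => [leEu|nEu].
  congr (_%:R); congr nat_of_bool; apply/eqP/eqP => [->|uE]; first by rewrite addmC addmK.
  by rewrite -(submK leEu) uE addmC.
by case: eqP nEu => // ->; rewrite lem_addr.
Qed.

Lemma mps_monom0 : mps_monom 0%MM = 1.
Proof. by apply: mpseriesP => u /=; case: eqP. Qed.

Lemma mps_monom_prod (b : 'I_m -> bool) :
  \prod_(j < m) mps_var j ^+ b j = mps_monom [multinom (b j : nat) | j < m].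
Proof.
have -> : [multinom (b j : nat) | j < m] = (\sum_(j < m) U_(j) *+ b j)%MM.
  apply/mnmP => i; rewrite mnmE mnm_sumE (bigD1 i) //= big1 => [|j ji].
    by rewrite mulmnE mnm1E eqxx mul1n addn0.
  by rewrite mulmnE mnm1E (negPf ji).
rewrite (big_morph mps_monom mps_monomD mps_monom0); apply: eq_bigr => j _.
by case: (b j); rewrite ?expr0 ?mulm0n ?mps_monom0 // expr1 mulm1n.
Qed.

Lemma mpscoef_natM n a u : mpscoef (n%:R * a) u = n%:R * mpscoef a u.
Proof.
rewrite !mulr_natl; elim: n => [|n IH]; first by rewrite !mulr0n /= if_same.
by rewrite !mulrS mpscoefD IH.
Qed.

Lemma mpscoef_sum (I : Type) (s : seq I) (F : I -> mpseries m B) u :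
  mpscoef (\sum_(i <- s) F i) u = \sum_(i <- s) mpscoef (F i) u.
Proof.
apply: (big_morph (fun a => mpscoef a u)) => [a b|]; first exact: mpscoefD.
by rewrite /= if_same.
Qed.

Lemma mps_trunc_exp N n a u : (mdeg u < N)%N -> mpscoef (a ^+ n) u = (mps_trunc N a ^+ n)@_u.
Proof.
elim: n u => [|n IH] u uN; first by rewrite !expr0 mcoeff1 /=; case: eqP.
rewrite !exprS [LHS](@mps_mulE m B N _ _ u uN).
apply: mcoeff_mul_eq => // v vu; rewrite mps_truncE ?IH //; exact: leq_ltn_trans uN.
Qed.

End PowerSeriesCoefficients.

Section FrobeniusCoefficients.
Import mpoly.
Variables (p : nat) (p_pr : prime p) (m : nat) (B : comNzRingType) (k : comNzRingType).
Hypothesis pk : p \in [pchar k].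
Variable kappa : {rmorphism B -> k}.

(** Modulo [p] the [p]-th power of a series is the sum of the [p]-th powers of its
    terms; a truncation of the series turns this into a finite sum. *)
Lemma mpscoef_expp (a : mpseries m B) (u : 'X_{1..m}) :
  kappa (mpscoef (a ^+ p) (u *+ p)%MM) = kappa (mpscoef a u) ^+ p.
Proof.
set N := (mdeg (u *+ p)%MM).+1; rewrite (mps_trunc_exp (N := N)) //.
rewrite -mcoeff_map_mpoly rmorphXn /= /mps_trunc rmorph_sum /=.
have p0 : (p%:R : {mpoly k[m]}) = 0.
  by rewrite -(rmorph_nat (@mpolyC m k)) (pcharf0 pk) rmorph0.
rewrite (exprp_sum p_pr p0) raddf_sum /=.
have uN : (mdeg u < N)%N by rewrite ltnS mdegMn leq_pmulr ?prime_gt0.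
have term (i : 'X_{1..m < N}) : (map_mpoly kappa (mpscoef a i *: 'X_[i]) ^+ p)@_(u *+ p) =
    if i == BMultinom uN then kappa (mpscoef a u) ^+ p else 0.
  rewrite map_mpolyZ map_mpolyX exprZn mpolyXn mcoeffZ mcoeffX.
  case: (eqVneq i) => [->|iu]; first by rewrite eqxx mulr1.
  case: eqP => [E|_]; last by rewrite mulr0.
  case/eqP: iu; apply/val_inj/mnmP => j; apply/eqP.
  by rewrite -(eqn_pmul2r (prime_gt0 p_pr)) -!mulmnE E.
by rewrite (eq_bigr _ (fun i _ => term i)) -big_mkcond big_pred1_eq.
Qed.

End FrobeniusCoefficients.

Section MonomialQuotient.
Import mpoly.
Variables (p : nat) (p_pr : prime p) (k : fieldType) (pk : p \in [pchar k]).
Hypothesis k_perfect : forall a : k, exists b : k, b ^+ p = a.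
Variables (m n : nat) (eps : 'I_n -> 'I_m.+1 -> bool).
Local Notation V := (witt p_pr k).
Local Notation A := (mpseries m V).
Local Notation I := (monomial_ideal p_pr k eps).
Local Notation R := (monomial_quotient p_pr k eps).
Local Notation pi := (quot_pi I : {rmorphism A -> R}).
Implicit Types (a : A) (u : 'X_{1..m}) (e : 'I_m.+1 -> bool).

Definition var_exponent e : 'X_{1..m} := [multinom (e (lift ord0 j) : nat) | j < m].

Lemma squarefree_monomialE e :
  squarefree_monomial p_pr k e = (p ^ e ord0)%:R * mps_monom V (var_exponent e).
Proof.
rewrite /squarefree_monomial big_ord_recl /parameter unlift_none -natrX; congr (_ * _).
rewrite -mps_monom_prod; apply: eq_bigr => j _; by rewrite liftK.
Qed.

(** Some generator whose exponent at [p] satisfies [Q] has a variable part that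
    divides [x^u].  The coefficients at [x^u] of the elements of [I] fill the
    whole of [V] when this holds for [negb], and at least [pV] when it holds for
    [xpredT]. *)
Definition divides_in (Q : pred bool) u :=
  [exists i, Q (eps i ord0) && (var_exponent (eps i) <= u)%MM].
Local Notation unit_at u := (divides_in negb u).
Local Notation mon_at u := (divides_in xpredT u).

Lemma divides_in_le Q u v : (u <= v)%MM -> divides_in Q u -> divides_in Q v.
Proof.
move=> uv /existsP [i /andP [Qi iu]]; apply/existsP; exists i.
by rewrite Qi (lepm_trans iu uv).
Qed.

(** Squarefreeness enters here: only the support of [u] matters. *)
Lemma divides_in_muln Q u : divides_in Q (u *+ p)%MM -> divides_in Q u.
Proof.
move=> /existsP [i /andP [Qi /mnm_lepP iu]]; apply/existsP; exists i.
rewrite Qi; apply/mnm_lepP => j; have := iu j; rewrite mulmnE mnmE.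
by case: (eps i _) => //; rewrite muln_gt0 => /andP [].
Qed.

Lemma unit_at_mon_at u : unit_at u -> mon_at u.
Proof. by move=> /existsP [i /andP [_ iu]]; apply/existsP; exists i. Qed.

(** Conversely to the inspection of the generators, a series with such
    coefficients is cut into pieces, one for each generator: every monomial goes
    to a generator that divides it, one without the factor [p] if possible, and
    the piece of a generator is divisible by it. *)
Lemma monomial_idealP a : I a <-> forall u,
  [\/ unit_at u, mon_at u /\ pdvd p 1 (mpscoef a u) | mpscoef a u = 0].
Proof.
split.
  pose K (b : A) := forall u, [\/ unit_at u, mon_at u /\ pdvd p 1 (mpscoef b u) | mpscoef b u = 0].
  have Kmon b u : K b -> ~~ unit_at u -> pdvd p 1 (mpscoef b u).
    by move=> /(_ u) [->|[]|->] // _; apply: pdvd0.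
  have Kzero b u : K b -> ~~ mon_at u -> mpscoef b u = 0.
    by move=> /(_ u) [/unit_at_mon_at ->|[->]|].
  have K0 : K 0 by move=> u; apply: Or33; rewrite /= if_same.
  have Kred b : (forall u, ~~ unit_at u -> pdvd p 1 (mpscoef b u)) ->
      (forall u, ~~ mon_at u -> mpscoef b u = 0) -> K b.
    move=> bp b0 u; have [uu|uu] := boolP (unit_at u); first exact: Or31.
    have [mu|mu] := boolP (mon_at u); last by apply: Or33; apply: b0.
    by apply: Or32; split=> //; apply: bp.
  have KD b c : K b -> K c -> K (b + c).
    move=> Kb Kc; apply: Kred => u uu; rewrite mpscoefD; last by rewrite !Kzero // addr0.
    by apply: pdvdD; apply: Kmon.
  have not_below Q (v w u : 'X_{1..m}) : u = (v + w)%MM -> ~~ divides_in Q u -> ~~ divides_in Q w.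
    by move=> ->; apply: contra; apply: divides_in_le; apply: lem_addl.
  have KM c b : K b -> K (c * b).
    move=> Kb; apply: Kred => u uu; rewrite mpscoefM.
      apply: pdvd_sum => i /eqP uE; apply/pdvdMl/Kmon => //; exact: not_below uE uu.
    rewrite big1 // => i /eqP uE; rewrite [mpscoef b _]Kzero ?mulr0 //.
    exact: not_below uE uu.
  move/(_ (Ideal K0 KD KM)); apply => _ [i ->] /= u.
  rewrite squarefree_monomialE mpscoef_natM /=.
  case: eqP => [->|_]; last by apply: Or33; rewrite mulr0.
  have mi (Q : pred bool) : Q (eps i ord0) -> divides_in Q (var_exponent (eps i)).
    by move=> Qi; apply/existsP; exists i; rewrite Qi lepm_refl.
  case Ei: (eps i ord0); last by apply: Or31; apply: mi; rewrite Ei.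
  by apply: Or32; split; [exact: mi | exact: pdvd_mulp].
move=> aP.
pose owner u : option 'I_n :=
  if [pick i | ~~ eps i ord0 && (var_exponent (eps i) <= u)%MM] is Some i then Some i
  else [pick i | var_exponent (eps i) <= u]%MM.
have owner_le u i : owner u = Some i -> (var_exponent (eps i) <= u)%MM.
  by rewrite /owner; case: pickP => [j /andP [_ ju] [<-]|_] //; case: pickP => // j ju [<-].
have owner_none u : owner u = None -> mpscoef a u = 0.
  rewrite /owner; case: pickP => // no_unit; case: pickP => // no_mon _.
  case: (aP u) => // [/existsP [i]|[/existsP [i]]]; first by rewrite no_unit.
  by rewrite no_mon.
have owner_dvd u : exists y, forall i, owner u = Some i ->
    mpscoef a u = (p ^ eps i ord0)%:R * y.
  case E: (owner u) => [i|]; last by exists 0.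
  case Ei: (eps i ord0); last by exists (mpscoef a u) => _ [<-]; rewrite Ei mul1r.
  suff [y yE] : pdvd p 1 (mpscoef a u) by exists y => _ [<-]; rewrite Ei.
  move: E; rewrite /owner; case: pickP => [j /andP [nj _] [ji]|no_unit _].
    by rewrite ji Ei in nj.
  case: (aP u) => [/existsP [j]|[]|->] //; first by rewrite no_unit.
  exact: pdvd0.
have [y yE] := choice owner_dvd.
pose part i : A := MPSeries (fun u => if owner u == Some i then mpscoef a u else 0).
have -> : a = \sum_i part i.
  apply: mpseriesP => u; rewrite mpscoef_sum /=.
  case E: (owner u) => [i|]; last by rewrite owner_none // big1.
  rewrite (bigD1 i) //= eqxx big1 ?addr0 // => j ji.
  by case: eqP => // -[ij]; rewrite ij eqxx in ji.
apply: ideal_sum => i.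
pose E := var_exponent (eps i).
have -> : part i = MPSeries (fun v => if owner (v + E)%MM == Some i then y (v + E)%MM else 0)
    * squarefree_monomial p_pr k (eps i).
  apply: mpseriesP => u; rewrite squarefree_monomialE mulrCA mpscoef_natM.
  rewrite [_ * mps_monom _ _]mulrC mpscoef_monomM !mpscoefE -/E.
  have [leEu|nEu] := boolP (E <= u)%MM.
    rewrite submK //; case: (owner u =P Some i) => [Eu|_]; last by rewrite mulr0.
    exact: yE.
  rewrite mulr0; case: eqP => // /owner_le Eu; by rewrite Eu in nEu.
by apply: idealM; apply: gen_idealP; exists i.
Qed.

(** The common reason why [R/p] ([Q := negb]) and [R/(R[p] + pR)] ([Q := xpredT])
    are reduced. *)
Lemma coef_pdvd_expp Q a :
  (forall u, divides_in Q u \/ pdvd p 1 (mpscoef (a ^+ p) u)) ->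
  forall u, divides_in Q u \/ pdvd p 1 (mpscoef a u).
Proof.
move=> aP u; case: (aP (u *+ p)%MM) => [/divides_in_muln|/(witt_pdvd1P pk k_perfect) a0]; [by left | right].
apply/(witt_pdvd1P pk k_perfect); move: a0; rewrite (mpscoef_expp p_pr pk (@witt_ghost p p_pr k 0)).
by move/eqP; rewrite expf_eq0 => /andP [_ /eqP].
Qed.

Lemma quot_pdvdP N a : pdvd p N (pi a) <-> exists b, I (a - (p ^ N)%:R * b).
Proof.
split=> [[y]|[b ab]]; last first.
  by exists (pi b); rewrite -(rmorph_nat pi) -rmorphM; apply/quot_pi_eq.
elim/quot_piW: y => b; rewrite -(rmorph_nat pi) -rmorphM => /quot_pi_eq ab.
by exists b.
Qed.

Lemma quot_eq0 a : pi a = 0 <-> I a.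
Proof. by rewrite -(rmorph0 pi) quot_pi_eq subr0. Qed.

Lemma series_divp (Q : pred 'X_{1..m}) a : (forall u, Q u \/ pdvd p 1 (mpscoef a u)) ->
  exists b : A, forall u, ~~ Q u -> mpscoef a u = p%:R * mpscoef b u.
Proof.
move=> aQ; have /choice [b bE] u : exists y, ~~ Q u -> mpscoef a u = p%:R * y.
  by case: (aQ u) => [->|/pdvd1 [y ->]]; [exists 0 | exists y].
by exists (MPSeries b).
Qed.

Lemma quot_pdvd1P a : pdvd p 1 (pi a) <-> forall u, unit_at u \/ pdvd p 1 (mpscoef a u).
Proof.
split=> [/quot_pdvdP [b /monomial_idealP ab] u|aP].
  have pb : pdvd p 1 (mpscoef ((p ^ 1)%:R * b) u) by rewrite mpscoef_natM; apply: pdvd_mulp.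
  rewrite -[a](subrK ((p ^ 1)%:R * b)) mpscoefD.
  case: (ab u) => [|[_ ?]|->]; [by left | right | right]; first exact: pdvdD.
  by rewrite add0r.
have [b bE] := series_divp aP.
apply/quot_pdvdP; exists b; apply/monomial_idealP => u.
have [uu|uu] := boolP (unit_at u); first exact: Or31.
by apply: Or33; rewrite mpscoefD mpscoefN mpscoef_natM expn1 bE // subrr.
Qed.

Lemma quot_torsion_pdvdP a : pdvd p 2 (p%:R * pi a) <->
  forall u, mon_at u \/ pdvd p 1 (mpscoef a u).
Proof.
rewrite -(rmorph_nat pi) -rmorphM; split=> [/quot_pdvdP [b /monomial_idealP ab] u|aP].
  case: (ab u) => [/unit_at_mon_at|[]|]; [by left | by left |].
  rewrite mpscoefD mpscoefN !mpscoef_natM expnS expn1 natrM -mulrA -mulrBr.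
  move/(witt_p_torsion_free pk)/eqP; rewrite subr_eq0 => /eqP ->.
  by right; apply/pdvd1; exists (mpscoef b u).
have [b bE] := series_divp aP.
apply/quot_pdvdP; exists b; apply/monomial_idealP => u.
rewrite mpscoefD mpscoefN !mpscoef_natM expnS expn1 natrM -mulrA -mulrBr.
have [mu|mu] := boolP (mon_at u); last by apply: Or33; rewrite bE // subrr mulr0.
by apply: Or32; split=> //; apply/pdvd1; eexists.
Qed.

Lemma monomial_quotient_p_reduced : p_reduced p R.
Proof.
split.
- have pE b : p%:R * pi b = pi (p%:R * b) by rewrite rmorphM rmorph_nat.
  elim/quot_piW=> a; rewrite (pE a) (pE (p%:R * a)) => /quot_eq0/monomial_idealP aP.
  apply/quot_eq0/monomial_idealP => u; have := aP u; rewrite !mpscoef_natM.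
  move=> [uu|[mu _]|a0]; [exact: Or31 | apply: Or32; split=> // | apply: Or33].
    by apply/pdvd1; exists (mpscoef a u).
  exact: (witt_p_torsion_free pk a0).
- elim/quot_piW=> a; rewrite -rmorphXn => /quot_pdvd1P/coef_pdvd_expp aP.
  exact/quot_pdvd1P.
- elim/quot_piW=> a; rewrite -rmorphXn => /quot_torsion_pdvdP/coef_pdvd_expp aP.
  exact/quot_torsion_pdvdP.
- elim/quot_piW=> a aP; apply/quot_eq0/monomial_idealP => u.
  have [uu|uu] := boolP (unit_at u); first exact: Or31.
  have [mu|mu] := boolP (mon_at u).
    by apply: Or32; split=> //; case: ((quot_pdvd1P a).1 (aP 1%N) u) => //; rewrite (negPf uu).
  apply: Or33; apply: (witt_p_separated pk k_perfect) => N.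
  have [b /monomial_idealP /(_ u)] := (quot_pdvdP N a).1 (aP N).
  rewrite (negPf uu) (negPf mu) mpscoefD mpscoefN mpscoef_natM => -[//|[]//|/eqP].
  by rewrite subr_eq0 => /eqP ->; apply: pdvd_mulp.
- move=> w; have /choice [a aE] l : exists a, w l = pi a.
    by elim/quot_piW: (w l) => a; exists a.
  have sE u := witt_p_complete pk k_perfect (fun l => mpscoef (a l) u).
  have [s sP] := choice sE; exists (pi (MPSeries s)) => N.
  have -> : psum p w N = pi (psum p a N).
    by rewrite rmorph_sum; apply: eq_bigr => l _; rewrite rmorphM rmorph_nat aE.
  have [b bP] := choice (fun u => sP u N).
  rewrite -rmorphB; exists (pi (MPSeries b)); rewrite -(rmorph_nat pi) -rmorphM; congr (pi _).
  apply: mpseriesP => u; rewrite mpscoefD mpscoefN mpscoef_natM /= -bP mpscoef_sum.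
  by congr (_ - _); apply: eq_bigr => l _; rewrite mpscoef_natM.
Qed.

End MonomialQuotient.

(** * The reduced tower *)

Section WittLocal.
Variables (p : nat) (p_pr : prime p) (k : fieldType) (pk : p \in [pchar k]).
Hypothesis k_perfect : forall a : k, exists b : k, b ^+ p = a.
Local Notation V := (witt p_pr k).

Lemma witt_p_nonunit : ~ pdvd p 1 (1 : V).
Proof. by move/(witt_pdvd1P pk k_perfect)/eqP; rewrite rmorph1 oner_eq0. Qed.

Lemma witt_local (v : V) : ~ pdvd p 1 v -> exists w, v * w = 1.
Proof.
move=> v_unit; pose w : V := Witt p_pr (fun n => if n is 0%N then (witt_ghost 0 v)^-1 else 0).
have w0 : witt_ghost 0 w = (witt_ghost 0 v)^-1.
  by rewrite {1}/witt_ghost WittPoly.ghost_recr big_ord0 add0r mul1r.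
have /pdvd1 [x xE] : pdvd p 1 (1 - v * w).
  apply/(witt_pdvd1P pk k_perfect); rewrite witt_ghostB [X in _ - X]witt_ghostM w0 witt_ghost1.
  rewrite divff ?subrr //.
  by apply/eqP => v0; apply: v_unit; apply/(witt_pdvd1P pk k_perfect).
have [y xy] := p_complete_inv x (@witt_p_separated p p_pr k pk k_perfect)
  (@witt_p_complete p p_pr k pk k_perfect).
by exists (w * y); rewrite mulrA -xy -xE opprB addrC subrK.
Qed.

End WittLocal.

(* The number of parameters is d = m.+1; V = witt p_pr k, A = mpseries m V,  *)
(* and K is any field containing V in which a compatible system of p-power   *)
(* roots of p has been chosen.                                               *)
Theorem proposition5p27 (p : nat) (p_pr : prime p) (k : fieldType)
    (pcharkp : p \in [pchar k])
    (k_perfect : forall a : k, exists b : k, b ^+ p = a)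
    (m n : nat) (eps : 'I_n -> 'I_m.+1 -> bool)
    (delta : delta_structure p (mpseries m (witt p_pr k)))
    (delta_witt : forall w : witt p_pr k,
      delta_frobenius p_pr delta (mps_const w) =
        mps_const (witt_frobenius p_pr pcharkp w))
    (delta_var : forall j : 'I_m, delta (mps_var j) = 0)
    (K : fieldType) (iota : {rmorphism witt p_pr k -> K})
    (iota_inj : injective iota) (pi : p_power_roots p K) :
  @perfectoid_tower p (monomial_quotient p_pr k eps) (principal p%:R)
    (reduced_tower eps delta_var iota pi)
    (reduced_tower_base eps delta_var iota pi).
Proof.
have root_pow i : pi i ^+ (p ^ i) = p%:R.
  by elim: i => [|i IH]; [rewrite proot0 | rewrite expnS exprM prootS].
have root_in i : pi i \in adjoin iota (pi i).
  by apply/asboolP; exists 'X; rewrite map_polyX hornerX.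
pose root i : root_ring iota pi i := AdjoinRing (root_in i).
have root_ext i : radical_ext p (p ^ i) (adjoin_const iota (pi i)) (root i).
  apply: adjoin_radical_ext => //.
  - exact: witt_p_torsion_free.
  - exact: witt_p_separated.
  - exact: witt_p_nonunit.
  - exact: witt_local.
  - by rewrite expn_gt0 prime_gt0.
have phiP (r : monomial_quotient p_pr k eps) :
    exists s, phiR eps delta_var r = r ^+ p + p%:R * s.
  elim/quot_piW: r => a; rewrite quot_mapE delta_frobeniusE rmorphD rmorphM rmorph_nat rmorphXn.
  by eexists.
have next_base i r : tensor_next eps delta_var iota pi i (pure _ _ r 1) =
    pure _ _ (phiR eps delta_var r) 1.
  by rewrite [LHS]tensor_mapE rmorph1.
have next_root i : tensor_next eps delta_var iota pi i (tensor_inr _ _ (root i)) =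
    tensor_inr _ _ (root i.+1) ^+ p.
  rewrite [LHS]tensor_mapE rmorph1 -rmorphXn; congr (pure _ _ 1 _).
  by apply: val_inj; rewrite rmorphXn; exact/esym/prootS.
have ext i := tensor_radical_ext (colim_alg eps delta_var i) (root_ext i).
have R_red := monomial_quotient_p_reduced p_pr pcharkp k_perfect eps.
refine (@radical_tower_perfectoid p p_pr _ (phiR eps delta_var) R_red phiP
  (tensor_ring eps delta_var iota pi) _ _
  (tensor_next eps delta_var iota pi) ext next_base next_root).
Qed.
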